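(* Let $D\subset\mathbb{R}^2$ be a disc with center $q$, let $D^*=D\setminus\{q\}$, and let $\psi:D^*\to\mathbb{R}^3$ be an immersed $K$-surface with an isolated singularity at $p=\psi(q)$. The following two conditions are equivalent: (i) $\psi$ has finite area around $p$. (ii) $\psi$ has finite total mean curvature around $p$, i.e. $\int |H|\,dA<\infty$ around $p$.
   Context: A $K$-surface in $\mathbb{R}^3$ is an immersed surface of constant (Gaussian) curvature $K=1$. An immersion $\psi:D^*\to\mathbb{R}^3$ is said to have an isolated singularity at $p=\psi(q)\in\mathbb{R}^3$ if $\psi$ extends continuously to $D$ (with $\psi(q)$ the value of this extension at $q$). $H$ denotes the mean curvature of $\psi$ and $dA$ the area element of its induced metric (first fundamental form). ''Around $p$'' means on some punctured neighborhood of $q$ in $D$. *)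

(* Defs.v *)
From HB Require Import structures.
From mathcomp Require Import all_boot all_order all_algebra.
From mathcomp Require Import all_classical all_reals all_analysis.

Set Implicit Arguments.
Unset Strict Implicit.
Unset Printing Implicit Defensive.

Import Order.TTheory GRing.Theory Num.Theory.
Import numFieldNormedType.Exports.

Local Open Scope classical_set_scope.
Local Open Scope ring_scope.

(* The norms that the library puts on R * R and 'rV[R]_3 are sup norms; they
   are only used for topology and differentiability.  All metric notions (the
   disc, dot products, lengths) are written out in Euclidean form. *)

Definition disc (R : realType) (q : R * R) (rho : R) : set (R * R) :=
  [set x | (x.1 - q.1) ^+ 2 + (x.2 - q.2) ^+ 2 < rho ^+ 2].

Definition punctured (R : realType) (q : R * R) (U : set (R * R)) :
  set (R * R) := U `\ q.

Definition dotp (R : realType) (u v : 'rV[R]_3) : R :=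
  \sum_k u 0 k * v 0 k.

(* 'I_3 carries addition modulo 3, so this is the cyclic formula
   (u x v)_k = u_(k+1) v_(k+2) - u_(k+2) v_(k+1). *)
Definition crossp (R : realType) (u v : 'rV[R]_3) : 'rV[R]_3 :=
  \row_k (u 0 (k + 1) * v 0 (k + 1 + 1) - u 0 (k + 1 + 1) * v 0 (k + 1)).

Definition basis2 (R : realType) (i : 'I_2) : R * R :=
  if i == 0 then (1, 0) else (0, 1).

Definition partial (R : realType) (i : 'I_2) (f : R * R -> 'rV[R]_3) :
  R * R -> 'rV[R]_3 := fun x => 'D_(basis2 R i) f x.

(* C^k on an open set U. *)
Fixpoint Ck (R : realType) (k : nat) (U : set (R * R))
    (f : R * R -> 'rV[R]_3) : Prop :=
  if k is k'.+1 then
    (forall x, U x -> differentiable f x) /\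
    (forall i : 'I_2, Ck k' U (partial i f))
  else forall x, U x -> {for x, continuous f}.

Definition smooth_on (R : realType) (U : set (R * R))
    (f : R * R -> 'rV[R]_3) : Prop := forall k, Ck k U f.

Definition immersion_on (R : realType) (U : set (R * R))
    (psi : R * R -> 'rV[R]_3) : Prop :=
  smooth_on U psi /\ (forall x, U x -> injective ('d psi x : R * R -> 'rV[R]_3)).

Definition unit_normal (R : realType) (psi : R * R -> 'rV[R]_3) (x : R * R) :
    'rV[R]_3 :=
  let w := crossp (partial 0 psi x) (partial 1 psi x) in
  (Num.sqrt (dotp w w))^-1 *: w.

Definition first_form (R : realType) (psi : R * R -> 'rV[R]_3) (x : R * R) :
    'M[R]_2 :=
  \matrix_(i, j) dotp (partial i psi x) (partial j psi x).

Definition second_form (R : realType) (psi : R * R -> 'rV[R]_3) (x : R * R) :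
    'M[R]_2 :=
  \matrix_(i, j) dotp (partial i (partial j psi) x) (unit_normal psi x).

(* Matrix of the Weingarten map in the basis of coordinate vector fields;
   first_form is invertible wherever psi is an immersion. *)
Definition shape_operator (R : realType) (psi : R * R -> 'rV[R]_3)
    (x : R * R) : 'M[R]_2 :=
  invmx (first_form psi x) *m second_form psi x.

Definition gauss_curvature (R : realType) (psi : R * R -> 'rV[R]_3)
    (x : R * R) : R := \det (shape_operator psi x).

Definition mean_curvature (R : realType) (psi : R * R -> 'rV[R]_3)
    (x : R * R) : R := \tr (shape_operator psi x) / 2.

Definition K_surface (R : realType) (U : set (R * R))
    (psi : R * R -> 'rV[R]_3) : Prop :=
  immersion_on U psi /\ (forall x, U x -> gauss_curvature psi x = 1).

(* The values of psi off D \ {q}, in particular at q, are irrelevant: p is the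
   value at q of the continuous extension. *)
Definition isolated_singularity (R : realType) (D : set (R * R)) (q : R * R)
    (psi : R * R -> 'rV[R]_3) (p : 'rV[R]_3) : Prop :=
  exists Psi : R * R -> 'rV[R]_3,
    [/\ {within D, continuous Psi},
        forall x, punctured q D x -> Psi x = psi x
      & Psi q = p].

(* Density of dA with respect to Lebesgue measure: sqrt (E G - F^2). *)
Definition area_density (R : realType) (psi : R * R -> 'rV[R]_3)
    (x : R * R) : R := Num.sqrt (\det (first_form psi x)).

Definition lebesgue2 (R : realType) :=
  (@lebesgue_measure R \x @lebesgue_measure R)%E.

Definition area_integral (R : realType) (psi : R * R -> 'rV[R]_3)
    (U : set (R * R)) (h : R * R -> R) : \bar R :=
  (\int[@lebesgue2 R]_(x in U) (h x * area_density psi x)%:E)%E.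

Definition finite_area_around (R : realType) (D : set (R * R)) (q : R * R)
    (psi : R * R -> 'rV[R]_3) : Prop :=
  exists U : set (R * R),
    [/\ open U, U q, U `<=` D
      & (area_integral psi (punctured q U) (fun=> 1%R) < +oo)%E].

Definition finite_total_mean_curvature_around (R : realType)
    (D : set (R * R)) (q : R * R) (psi : R * R -> 'rV[R]_3) : Prop :=
  exists U : set (R * R),
    [/\ open U, U q, U `<=` D
      & (area_integral psi (punctured q U)
           (fun x => `|mean_curvature psi x|%R) < +oo)%E].

(* Main.v *)
Require Import Defs.
From mathcomp Require Import all_boot all_order all_algebra.
From mathcomp Require Import all_classical all_reals all_analysis.
From mathcomp Require Import measurable_realfun.
From mathcomp Require Import ring lra.

(** Why the two conditions are equivalent.

    Write N for the unit normal, W = sqrt (E G - F^2) for the area density,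
    e, f, g for the coefficients of the second form and H for the mean
    curvature, and put K = 1.

    Finite total mean curvature gives finite area because H^2 >= K = 1
    ([mean_curvature_ge1]): the area is at most the integral of |H|.

    The converse is a Minkowski formula with a weight that depends on the
    distance to the singularity.  Let X = psi - p and s = |X|^2 / 2.  The 1-form
    beta = <X, N x dN> satisfies
        d beta = 2 (H + <X, N>) dA                            ([flux_curl]),
    and ds /\ beta = II(V, V) dA, where V is the vector with dpsi(V) = N x X
    ([flux_radial]).  As K > 0 the second form
    is definite, and its sign is the sign of H, so sgn(H) ds /\ beta >= 0.
    Moreover sgn H is locally constant, because H is continuous and |H| >= 1.
    Now let theta be a nondecreasing function with values in [0, 1], and let Q
    be a closed square centred at q.  Then
        2 theta(s) |H| dA <= d (theta(s) sgn(H) beta) + 2 |<X, N>| dA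
    ([flow_divergence_le]): the term theta'(s) sgn(H) ds /\ beta that the
    product rule produces has the favourable sign and can be dropped.  When
    theta vanishes near 0, the 1-form on the right extends by zero across q, since
    X tends to 0 there.  Green's formula on Q then bounds the integral of the
    exact term by boundary terms that involve only |beta| on the boundary of Q,
    hence do not depend on theta ([div_bound]); the last term is at most a
    constant times the area of the surface over Q.  So the integral of
    theta(s) |H| is bounded uniformly in theta ([weight_bound]).  Letting theta
    increase to the indicator of the positive reals, monotone convergence bounds
    the integral of |H| over the points of Q where psi differs from p.

    The remaining set, where psi = p, is negligible: psi has a nonzero
    derivative along vertical lines, so the points of this set are isolated in
    each vertical line, hence countably many there ([sdist_null]).

    Every computation takes place in the given coordinates; the symmetry of second
    derivatives of psi and of N ([schwarz]) is the only integrability condition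
    that enters. *)

Set Implicit Arguments.
Unset Strict Implicit.
Unset Printing Implicit Defensive.

Import Order.TTheory GRing.Theory Num.Theory.
Import numFieldNormedType.Exports.

Local Open Scope classical_set_scope.
Local Open Scope ring_scope.

(** * Functions of class C^k on an open subset of the plane *)

Section Cks.
Variable R : realType.
Implicit Types (U : set (R * R)) (f g : R * R -> R) (F G : R * R -> 'rV[R]_3).

Definition pd (i : 'I_2) f : R * R -> R := fun x => 'D_(basis2 R i) f x.

Lemma pdE i f x df : is_derive x (basis2 R i) f df -> pd i f x = df.
Proof. by move=> h; rewrite /pd derive_val. Qed.

Lemma pdP i f x : derivable f x (basis2 R i) ->
  is_derive x (basis2 R i) f (pd i f x).
Proof. exact: derivableP. Qed.

(** Differentiability is replaced by continuity together with partial
    derivatives.  This weaker form suffices for the symmetry of second derivatives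
    and for Green's formula, and its stability under products and composition is
    a plain induction on k. *)
Fixpoint Cks (k : nat) U f : Prop :=
  if k is k'.+1 then
    [/\ forall x, U x -> {for x, continuous f},
        forall (i : 'I_2) x, U x -> derivable f x (basis2 R i)
      & forall i : 'I_2, Cks k' U (pd i f)]
  else forall x, U x -> {for x, continuous f}.

Definition Ckv k U F := forall j, Cks k U (fun x => F x 0 j).

Lemma Cks_cts k U f x : Cks k U f -> U x -> {for x, continuous f}.
Proof. by case: k => [|k] /=; [exact|case=> + _ _ => /[apply]]. Qed.

Lemma Cks_derivable k U f i x : Cks k.+1 U f -> U x ->
  derivable f x (basis2 R i).
Proof. by rewrite /=; case=> _ + _; exact. Qed.

Lemma Cks_partial k U f i : Cks k.+1 U f -> Cks k U (pd i f).
Proof. by rewrite /=; case. Qed.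

Lemma Cks_le k l U f : (k <= l)%N -> Cks l U f -> Cks k U f.
Proof.
elim: k l f => [|k IH] [|l] f // kl.
- by rewrite /=; case.
- by rewrite /=; move=> [cf df Df]; split => // i; exact: IH (Df i).
Qed.

Lemma near_open U f g : open U -> (forall x, U x -> f x = g x) ->
  forall x, U x -> {near x, f =1 g}.
Proof.
move=> oU fg x Ux.
by apply: filterS (open_nbhs_nbhs (conj oU Ux)) => y /fg.
Qed.

Lemma Cks_ext k U f g : open U -> (forall x, U x -> f x = g x) ->
  Cks k U f -> Cks k U g.
Proof.
move=> oU; elim: k f g => [|k IH] f g fg.
  move=> cf x Ux; rewrite /prop_for /continuous_at -(fg _ Ux).
  by apply: cvg_trans (cf x Ux); exact/near_eq_cvg/(near_open oU fg).
have c0 : Cks 0 U f -> Cks 0 U g.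
  move=> cf x Ux; rewrite /prop_for /continuous_at -(fg _ Ux).
  by apply: cvg_trans (cf x Ux); exact/near_eq_cvg/(near_open oU fg).
move=> [cf df Df]; split; first exact: c0.
  by move=> i x Ux; apply: near_eq_derivable (df i x Ux); exact: (near_open oU).
move=> i; apply: IH (Df i) => x Ux; apply: near_eq_derive.
exact: (near_open oU fg).
Qed.

Lemma Cks_cst k U (c : R) : open U -> Cks k U (fun=> c).
Proof.
move=> oU; elim: k c => [|k IH] c; first by move=> x _; exact: cvg_cst.
split=> [x _|i x _|i]; [exact: cvg_cst|exact: derivable_cst|].
by apply: (Cks_ext oU _ (IH 0)) => x _; rewrite /pd derive_cst.
Qed.

Lemma Cks_add k U f g : open U -> Cks k U f -> Cks k U g ->
  Cks k U (fun x => f x + g x).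
Proof.
move=> oU; elim: k f g => [|k IH] f g.
  by move=> cf cg x Ux; apply: cvgD; [exact: cf|exact: cg].
move=> [cf df Df] [cg dg Dg]; split=> [x Ux|i x Ux|i].
- by apply: cvgD; [exact: cf|exact: cg].
- by apply: derivableD; [exact: df|exact: dg].
- apply: (Cks_ext oU _ (IH _ _ (Df i) (Dg i))) => x Ux.
  by rewrite /pd -deriveD//; [exact: df|exact: dg].
Qed.

Lemma Cks_mul k U f g : open U -> Cks k U f -> Cks k U g ->
  Cks k U (fun x => f x * g x).
Proof.
move=> oU; elim: k f g => [|k IH] f g.
  by move=> cf cg x Ux; apply: cvgM; [exact: cf|exact: cg].
move=> Cf Cg; have [cf df Df] := Cf; have [cg dg Dg] := Cg.
split=> [x Ux|i x Ux|i].
- by apply: cvgM; [exact: cf|exact: cg].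
- by apply: derivableM; [exact: df|exact: dg].
- have C1 := IH _ _ (Cks_le (leqnSn k) Cf) (Dg i).
  have C2 := IH _ _ (Cks_le (leqnSn k) Cg) (Df i).
  apply: (Cks_ext oU _ (Cks_add oU C1 C2)) => x Ux.
  by rewrite /pd [RHS](@deriveM _ _ f g)//; [exact: df|exact: dg].
Qed.

Lemma Cks_opp k U f : open U -> Cks k U f -> Cks k U (fun x => - f x).
Proof.
move=> oU Cf; apply: (Cks_ext oU _ (Cks_mul oU (Cks_cst k (-1) oU) Cf)).
by move=> x _; rewrite mulN1r.
Qed.

Lemma Cks_sub k U f g : open U -> Cks k U f -> Cks k U g ->
  Cks k U (fun x => f x - g x).
Proof. by move=> oU Cf Cg; apply: Cks_add => //; exact: Cks_opp. Qed.

(** A directional derivative is an ordinary derivative along a line; this is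
    what brings one-variable rules such as the chain rule to the plane. *)
Lemma is_derive_line f x v (df : R) :
  is_derive x v f df <-> is_derive (0 : R) 1 (fun t : R => f (t *: v + x)) df.
Proof.
have E : 'D_v f x = 'D_1 (fun t : R => f (t *: v + x)) 0.
  rewrite /derive; set g1 := fun h => h^-1 *: _; set g2 := fun h => h^-1 *: _.
  suff -> : g1 = g2 by [].
  by rewrite funeqE /g1 /g2 => t /=; rewrite addr0 scale0r add0r [_%:A]mulr1.
split=> -[ex <-].
  by apply: DeriveDef; [exact: (iffLR (derivable1P _ _ _))|rewrite E].
by apply: DeriveDef; [exact: (iffRL (derivable1P _ _ _))|rewrite E].
Qed.

Lemma is_derive_compR f (h : R -> R) x v (df dh : R) :
  is_derive (f x) 1 h dh -> is_derive x v f df ->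
  is_derive x v (fun y => h (f y)) (dh * df).
Proof.
move=> hdh /is_derive_line fdf; apply/is_derive_line.
apply: (@is_derive1_comp _ h (fun t : R => f (t *: v + x))).
by rewrite scale0r add0r.
Qed.

End Cks.

Section Cks2.
Variable R : realType.
Implicit Types (U : set (R * R)) (f g : R * R -> R) (F G : R * R -> 'rV[R]_3).

Lemma basis20 : basis2 R 0 = (1, 0). Proof. by []. Qed.
Lemma basis21 : basis2 R 1 = (0, 1). Proof. by []. Qed.

Lemma is_derive_fst f (a b df : R) :
  is_derive (a, b) (basis2 R 0) f df <-> is_derive a 1 (fun t => f (t, b)) df.
Proof.
have Q : (fun h : R => h^-1 *: (f (h *: basis2 R 0 + (a, b)) - f (a, b))) =
         (fun h : R => h^-1 *: (f (h *: 1 + a, b) - f (a, b))).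
  apply/funext => h; congr (_ *: (f _ - _)).
  by rewrite basis20; congr pair => /=; rewrite scaler0 add0r.
by split=> -[ex <-]; apply: DeriveDef; move: ex; rewrite /derivable /derive /= Q.
Qed.

Lemma is_derive_snd f (a b df : R) :
  is_derive (a, b) (basis2 R 1) f df <-> is_derive b 1 (fun t => f (a, t)) df.
Proof.
have Q : (fun h : R => h^-1 *: (f (h *: basis2 R 1 + (a, b)) - f (a, b))) =
         (fun h : R => h^-1 *: (f (a, h *: 1 + b) - f (a, b))).
  apply/funext => h; congr (_ *: (f _ - _)).
  by rewrite basis21; congr pair => /=; rewrite scaler0 add0r.
by split=> -[ex <-]; apply: DeriveDef; move: ex; rewrite /derivable /derive /= Q.
Qed.

Lemma is_derive_row F x v (dF : 'rV[R]_3) :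
  is_derive x v F dF <-> forall j, is_derive x v (fun y => F y 0 j) (dF 0 j).
Proof.
split=> [[ex <-] j|H].
  have exj := (derivable_mxP _ _ _).1 ex 0 j.
  by apply: DeriveDef => //; rewrite derive_mx// mxE.
have ex : derivable F x v.
  by apply/derivable_mxP => i j; rewrite ord1; apply: ex_derive.
apply: DeriveDef => //; rewrite derive_mx//; apply/rowP => j; rewrite mxE.
exact: derive_val.
Qed.

Lemma is_derive_mulR f g x v (df dg : R) :
  is_derive x v f df -> is_derive x v g dg ->
  is_derive x v (fun y => f y * g y) (df * g x + f x * dg).
Proof.
move=> h1 h2; apply: (is_derive_eq (is_deriveM h1 h2)).
by rewrite /GRing.scale/= addrC mulrC.
Qed.

Lemma is_derive_dotp F G x v (dF dG : 'rV[R]_3) :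
  is_derive x v F dF -> is_derive x v G dG ->
  is_derive x v (fun y => dotp (F y) (G y)) (dotp dF (G x) + dotp (F x) dG).
Proof.
move=> /is_derive_row hF /is_derive_row hG; rewrite /dotp -big_split/=.
have -> : (fun y => \sum_k F y 0 k * G y 0 k) =
          \sum_(k < 3) (fun y => F y 0 k * G y 0 k).
  by apply/funext => y; rewrite fct_sumE.
by apply: is_derive_sum => i; exact: is_derive_mulR.
Qed.

Lemma is_derive_crossp F G x v (dF dG : 'rV[R]_3) :
  is_derive x v F dF -> is_derive x v G dG ->
  is_derive x v (fun y => crossp (F y) (G y))
    (crossp dF (G x) + crossp (F x) dG).
Proof.
move=> /is_derive_row hF /is_derive_row hG; apply/is_derive_row => j.
have -> : (fun y => crossp (F y) (G y) 0 j) =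
  (fun y => F y 0 (j + 1) * G y 0 (j + 1 + 1)) -
  (fun y => F y 0 (j + 1 + 1) * G y 0 (j + 1)).
  by apply/funext => y; rewrite mxE.
have h1 := is_derive_mulR (hF (j + 1)) (hG (j + 1 + 1)).
have h2 := is_derive_mulR (hF (j + 1 + 1)) (hG (j + 1)).
apply: (is_derive_eq (is_deriveB h1 h2)).
by rewrite !mxE; ring.
Qed.

Lemma partialE i F x : partial i F x = 'D_(basis2 R i) F x.
Proof. by []. Qed.

Lemma Ckv_derive k U F i x : Ckv k.+1 U F -> U x ->
  is_derive x (basis2 R i) F (partial i F x).
Proof.
move=> CF Ux; apply: derivableP; apply/derivable_mxP => a j; rewrite ord1.
exact: Cks_derivable (CF j) Ux.
Qed.

Lemma Ckv_ext k U F G : open U -> (forall x, U x -> F x = G x) ->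
  Ckv k U F -> Ckv k U G.
Proof. by move=> oU FG CF j; apply: Cks_ext (CF j) => // x /FG ->. Qed.

Lemma Ckv_partial k U F i : open U -> Ckv k.+1 U F -> Ckv k U (partial i F).
Proof.
move=> oU CF j; apply: (Cks_ext oU _ (Cks_partial i (CF j))) => x Ux.
have /is_derive_row/(_ j) := Ckv_derive i CF Ux.
exact: pdE.
Qed.

Lemma Ckv_dotp k U F G : open U -> Ckv k U F -> Ckv k U G ->
  Cks k U (fun x => dotp (F x) (G x)).
Proof.
move=> oU CF CG; rewrite /dotp.
apply: (@Cks_ext _ _ _ (fun x => F x 0 ord0 * G x 0 ord0 +
   (F x 0 (lift ord0 ord0) * G x 0 (lift ord0 ord0) +
   (F x 0 (lift ord0 (lift ord0 ord0)) * G x 0 (lift ord0 (lift ord0 ord0))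
    + 0)))) => //.
  by move=> x _; rewrite !big_ord_recl big_ord0.
by do 3! (apply: Cks_add => //; first exact: Cks_mul); exact: Cks_cst.
Qed.

Lemma Ckv_crossp k U F G : open U -> Ckv k U F -> Ckv k U G ->
  Ckv k U (fun x => crossp (F x) (G x)).
Proof.
move=> oU CF CG j.
apply: (@Cks_ext _ _ _ (fun x => F x 0 (j + 1) * G x 0 (j + 1 + 1) -
   F x 0 (j + 1 + 1) * G x 0 (j + 1))) => //; first by move=> x _; rewrite mxE.
by apply: Cks_sub => //; exact: Cks_mul.
Qed.

Lemma Ckv_scale k U f F : open U -> Cks k U f -> Ckv k U F ->
  Ckv k U (fun x => f x *: F x).
Proof.
move=> oU Cf CF j.
apply: (@Cks_ext _ _ _ (fun x => f x * F x 0 j)) => //.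
  by move=> x _; rewrite mxE.
exact: Cks_mul.
Qed.

Lemma Ck_Ckv k U F : open U -> Ck k U F -> Ckv k U F.
Proof.
move=> oU; elim: k F => [|k IH] F /=.
  move=> cF j x Ux.
  exact: (@cvg_comp _ _ _ F (fun M : 'rV[R]_3 => M 0 j) _ _ _ (cF x Ux)
    (@coord_continuous _ _ _ 0 j _)).
move=> [dF DF] j.
have exF i x : U x -> is_derive x (basis2 R i) F (partial i F x).
  by move=> Ux; apply: derivableP; exact/diff_derivable/dF.
split.
- move=> x Ux; have /differentiable_continuous cF := dF x Ux.
  exact: (@cvg_comp _ _ _ F (fun M : 'rV[R]_3 => M 0 j) _ _ _ cF
    (@coord_continuous _ _ _ 0 j _)).
- by move=> i x /(exF i)/is_derive_row/(_ j) h; exact: ex_derive.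
- move=> i; apply: (Cks_ext oU _ (IH _ (DF i) j)) => x Ux.
  by have /is_derive_row/(_ j)/pdE := exF i x Ux.
Qed.

Lemma is_derive_rsqrt (t : R) : 0 < t ->
  is_derive t 1 (fun t => (Num.sqrt t)^-1) (- 2^-1 * (Num.sqrt t)^-1 ^+ 3).
Proof.
move=> t0; have h := is_derive1_sqrt t0.
have s0 : Num.sqrt t != 0 by rewrite gt_eqF// sqrtr_gt0.
have ex : derivable (fun t : R => (Num.sqrt t)^-1) t 1.
  by apply: derivableV => //; exact: ex_derive.
apply: DeriveDef => //; rewrite deriveV// derive_val /GRing.scale/=.
by field.
Qed.

(** The derivative of t^(-1/2) is -1/2 times its cube, so each partial
    derivative of f^(-1/2) is a polynomial in f^(-1/2) and a partial derivative of
    f; this closes the induction on k.  It makes the unit normal smooth. *)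
Lemma Cks_rsqrt k U f : open U -> (forall x, U x -> 0 < f x) ->
  Cks k U f -> Cks k U (fun x => (Num.sqrt (f x))^-1).
Proof.
move=> oU f0; elim: k => [|k IH] Cf.
  move=> x Ux; apply: cvgV; first by rewrite gt_eqF// sqrtr_gt0 f0.
  by apply: continuous_cvg; [exact: sqrt_continuous|exact: Cf].
have dr i x : U x -> is_derive x (basis2 R i) (fun x => (Num.sqrt (f x))^-1)
    (- 2^-1 * (Num.sqrt (f x))^-1 ^+ 3 * pd i f x).
  move=> Ux; apply: (is_derive_compR (is_derive_rsqrt (f0 _ Ux))).
  by apply: pdP; exact: Cks_derivable Cf Ux.
have Ck := IH (Cks_le (leqnSn k) Cf).
split.
- move=> x Ux; apply: cvgV; first by rewrite gt_eqF// sqrtr_gt0 f0.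
  by apply: continuous_cvg; [exact: sqrt_continuous|exact: Cks_cts Cf Ux].
- by move=> i x Ux; have h := dr i x Ux; exact: ex_derive.
- move=> i; have C3 := Cks_mul oU Ck (Cks_mul oU Ck Ck).
  have := Cks_mul oU (Cks_mul oU (Cks_cst k (- 2^-1) oU) C3) (Cks_partial i Cf).
  apply: Cks_ext => // x Ux; rewrite (pdE (dr i x Ux)).
  by rewrite exprS expr2.
Qed.

End Cks2.

(** * Symmetry of second derivatives *)

Section Schwarz.
Variable R : realType.
Implicit Types (U : set (R * R)) (f g : R * R -> R).

Lemma MVT_derive (g dg : R -> R) (a c : R) : a < c ->
  (forall t, t \in `[a, c] -> is_derive t 1 g (dg t)) ->
  exists2 t, t \in `[a, c] & g c - g a = dg t * (c - a).
Proof.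
move=> ac hd.
have h1 t : t \in `]a, c[ -> is_derive t 1 g (dg t).
  by move=> tac; apply: hd; apply: subset_itv_oo_cc tac.
have h2 : {within `[a, c], continuous g}.
  by apply: derivable_within_continuous => t /hd h; exact: ex_derive.
have [t tac ->] := MVT ac h1 h2.
by exists t => //; apply: subset_itv_oo_cc tac.
Qed.

(** Two applications of the mean value theorem write the second difference of
    f over a small square of side h as h^2 times either mixed derivative, taken at
    some point of the square; continuity at x does the rest. *)
Lemma schwarz U f x : open U -> Cks 2 U f -> U x ->
  pd 1 (pd 0 f) x = pd 0 (pd 1 f) x.
Proof.
move=> oU Cf Ux.
pose A : R * R -> R := pd 1 (pd 0 f).
pose B : R * R -> R := pd 0 (pd 1 f).
rewrite -[LHS]/(A x) -[RHS]/(B x).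
have cA : {for x, continuous A}.
  exact: Cks_cts (Cks_partial 1 (Cks_partial 0 Cf)) Ux.
have cB : {for x, continuous B}.
  exact: Cks_cts (Cks_partial 0 (Cks_partial 1 Cf)) Ux.
apply/eqP; rewrite -subr_eq0 -normr_le0; apply/ler_addgt0Pl => e e0.
rewrite addr0; have e20 : 0 < e / 2 by rewrite divr_gt0.
have near3 : \forall y \near x,
    [/\ U y, `|A x - A y| < e / 2 & `|B x - B y| < e / 2].
  have nA : \forall y \near x, `|A x - A y| < e / 2.
    by move/cvgrPdist_lt : cA; apply.
  have nB : \forall y \near x, `|B x - B y| < e / 2.
    by move/cvgrPdist_lt : cB; apply.
  have nU : nbhs x U by exact: open_nbhs_nbhs.
  by apply: filterS (filterI nU (filterI nA nB)) => y [? []].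
have /nbhs_ballP[d /= d0 dP] := near3.
pose h := d / 2; have h0 : 0 < h by rewrite divr_gt0.
have hd : h < d by rewrite /h ltr_pdivrMr// ltr_pMr// ltr1n.
case: x => a b in Ux cA cB near3 dP *.
have box s t : s \in `[a, a + h] -> t \in `[b, b + h] -> ball (a, b) d (s, t).
  rewrite !in_itv/= => /andP[s1 s2] /andP[t1 t2].
  by split; rewrite /= /ball/= ltr_distlC; apply/andP; split; lra.
have inU s t : s \in `[a, a + h] -> t \in `[b, b + h] -> U (s, t).
  by move=> hs ht; have [] := dP _ (box _ _ hs ht).
have ah : a < a + h by rewrite ltrDl.
have bh : b < b + h by rewrite ltrDl.
have aE : a \in `[a, a + h] by rewrite in_itv/= lexx ltW.
have ahE : a + h \in `[a, a + h] by rewrite in_itv/= lexx ltW.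
have bE : b \in `[b, b + h] by rewrite in_itv/= lexx ltW.
have bhE : b + h \in `[b, b + h] by rewrite in_itv/= lexx ltW.
have d1 g s t : Cks 1 U g -> s \in `[a, a + h] -> t \in `[b, b + h] ->
    is_derive s 1 (fun s => g (s, t)) (pd 0 g (s, t)).
  move=> Cg hs ht; apply/is_derive_fst/pdP.
  exact: Cks_derivable Cg (inU _ _ hs ht).
have d2 g s t : Cks 1 U g -> s \in `[a, a + h] -> t \in `[b, b + h] ->
    is_derive t 1 (fun t => g (s, t)) (pd 1 g (s, t)).
  move=> Cg hs ht; apply/is_derive_snd/pdP.
  exact: Cks_derivable Cg (inU _ _ hs ht).
have Cf1 := Cks_le (leqnSn 1) Cf.
(* The second difference, first along the first coordinate, then along the
   second; the other order follows below. *)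
have [s1 s1E e1] := MVT_derive ah (fun s hs =>
  is_deriveB (d1 f s (b + h) Cf1 hs bhE) (d1 f s b Cf1 hs bE)).
have [t1 t1E e1'] := MVT_derive bh (fun t ht =>
  d2 _ s1 t (Cks_partial 0 Cf) s1E ht).
have [t2 t2E e2] := MVT_derive bh (fun t ht =>
  is_deriveB (d2 f (a + h) t Cf1 ahE ht) (d2 f a t Cf1 aE ht)).
have [s2 s2E e2'] := MVT_derive ah (fun s hs =>
  d1 _ s t2 (Cks_partial 1 Cf) hs t2E).
have AB : A (s1, t1) = B (s2, t2).
  have kE (k : R) : k + h - k = h by rewrite addrAC subrr add0r.
  rewrite e1' !kE in e1; rewrite e2' !kE in e2.
  have {}e1 : A (s1, t1) * h * h = B (s2, t2) * h * h.
    rewrite -[LHS]e1 -[RHS]e2.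
    change (f (a + h, b + h) - f (a + h, b) - (f (a, b + h) - f (a, b)) =
      f (a + h, b + h) - f (a, b + h) - (f (a + h, b) - f (a, b))).
    by ring.
  by apply: (mulIf (lt0r_neq0 h0)); apply: (mulIf (lt0r_neq0 h0)).
clearbody A B.
have [_ + _] := dP _ (box _ _ s1E t1E); have [_ _ +] := dP _ (box _ _ s2E t2E).
rewrite -AB => hB hA.
apply: (le_trans (ler_distD (A (s1, t1)) _ _)); rewrite (distrC _ (B (a, b))).
by rewrite (splitr e) lerD// ltW.
Qed.

End Schwarz.

(** * Continuously differentiable cutoffs *)

Section Cutoff.
Variable R : realType.
Implicit Types t : R.

(** A quadratic error bound at every increment avoids a separate treatment of
    the point where a piecewise function such as [sqpos] changes its formula. *)
Lemma quad_is_derive (f : R -> R) (t d : R) :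
  (forall h, `|f (h + t) - f t - h * d| <= h ^+ 2) -> is_derive t 1 f d.
Proof.
move=> H.
have cv : h^-1 *: (f (h *: (1 : R) + t) - f t) @[h --> 0^'] --> d.
  apply/cvgrPdist_le => e e0; near=> h.
  have h0 : h != 0 by near: h; exact: nbhs_dnbhs_neq.
  have he : `|h| <= e by near: h; exact: dnbhs0_le.
  have -> : d - h^-1 *: (f (h *: 1 + t) - f t) =
      - (h^-1 * (f (h + t) - f t - h * d)).
    by rewrite [h *: 1]mulr1 /GRing.scale/=; field.
  rewrite normrN normrM normfV (le_trans _ he)// ler_pdivrMl ?normr_gt0//.
  by rewrite (le_trans (H h))// -normrM -expr2 ler_norm.
apply: DeriveDef; first by apply/cvg_ex; exists d.
exact: cvg_lim.
Unshelve. all: by end_near. Qed.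

Definition sqpos t := Num.max 0 t ^+ 2.

Lemma sqpos_ge0 t : 0 <= sqpos t. Proof. exact: sqr_ge0. Qed.

Lemma is_derive_sqpos t : is_derive t 1 sqpos (2 * Num.max 0 t).
Proof.
apply: quad_is_derive => h; rewrite /sqpos ler_norml.
have := sqr_ge0 h; have := sqr_ge0 t; have := sqr_ge0 (h + t).
by case: (lerP 0 (h + t)) => h1; case: (lerP 0 t) => h2 H1 H2 H3;
  apply/andP; split; nra.
Qed.

(** A C^1 nondecreasing function from the reals to [0, 1) that vanishes exactly
    on the nonpositive reals. *)
Definition ramp t := sqpos t * (1 + sqpos t)^-1.
Definition dramp t := 2 * Num.max 0 t / (1 + sqpos t) ^+ 2.

Lemma is_derive_ramp t : is_derive t 1 ramp (dramp t).
Proof.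
have s0 : 1 + sqpos t != 0 by rewrite gt_eqF// ltr_pwDl// sqpos_ge0.
have h := is_derive_sqpos t.
have h1 := is_deriveD (is_derive_cst (1 : R) t (1 : R)) h.
have ex : derivable (fun t => (1 + sqpos t)^-1) t 1.
  by apply: (@derivableV _ _ (cst 1 + sqpos)) => //; exact: ex_derive.
have h2 : is_derive t 1 (fun t => (1 + sqpos t)^-1)
    (- (1 + sqpos t) ^- 2 * (0 + 2 * Num.max 0 t)).
  apply: DeriveDef => //.
  by rewrite (@deriveV _ _ (cst 1 + sqpos))// derive_val.
apply: (is_derive_eq (is_deriveM h h2)).
by rewrite /dramp /GRing.scale/=; field.
Qed.

Lemma ramp01 t : 0 <= ramp t <= 1.
Proof.
have s0 := sqpos_ge0 t; have s1 : 0 < 1 + sqpos t by rewrite ltr_pwDl.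
by rewrite /ramp mulr_ge0 ?invr_ge0 ?(ltW s1)//= ler_pdivrMr// mul1r lerDr.
Qed.

Lemma dramp_ge0 t : 0 <= dramp t.
Proof. by rewrite /dramp divr_ge0 ?sqr_ge0// mulr_ge0// le_max lexx. Qed.

Lemma ramp_eq0 t : t <= 0 -> ramp t = 0.
Proof. by move=> t0; rewrite /ramp /sqpos max_l// expr0n mul0r. Qed.

Lemma ramp_ge_half t : 1 <= t -> 1 / 2 <= ramp t.
Proof.
move=> t1; have t0 : 0 <= t by lra.
have s1 : 1 <= sqpos t by rewrite /sqpos max_r// expr_ge1.
rewrite /ramp ler_pdivlMr; lra.
Qed.

Lemma continuous_dramp : continuous dramp.
Proof.
move=> t; have s1 : 0 < 1 + sqpos t by rewrite ltr_pwDl// sqpos_ge0.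
have cm : {for t, continuous (fun t : R => Num.max 0 t)}.
  by apply: continuous_max; [exact: cvg_cst|exact: cvg_id].
apply: cvgM; first by apply: cvgM => //; exact: cvg_cst.
apply: cvgV; first by rewrite expf_neq0// gt_eqF.
have c1 : {for t, continuous (fun t : R => 1 + sqpos t)}.
  by apply: cvgD; [exact: cvg_cst|apply: cvgM].
by apply: cvgM.
Qed.

(** For k > 0, vanishes for t <= 1/k and is at least 1/2 for t >= 2/k, so that the cutoffs
    exhaust the positive reals as k grows. *)
Definition cutoff (k t : R) := ramp (k * t - 1).
Definition dcutoff (k t : R) := k * dramp (k * t - 1).

Lemma is_derive_cutoff k t : is_derive t 1 (cutoff k) (dcutoff k t).
Proof.
have h : is_derive t 1 (fun t => k * t - 1) k.
  have h1 := is_deriveB (is_deriveZ k (is_derive_id t (1 : R)))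
    (is_derive_cst (1 : R) t (1 : R)).
  by apply: (is_derive_eq h1); rewrite subr0 [_ *: _]mulr1.
have := @is_derive1_comp _ ramp (fun t => k * t - 1) t _ _ (is_derive_ramp _) h.
by rewrite mulrC.
Qed.

Lemma cutoff01 k t : 0 <= cutoff k t <= 1.
Proof. exact: ramp01. Qed.

Lemma dcutoff_ge0 k t : 0 <= k -> 0 <= dcutoff k t.
Proof. by move=> k0; rewrite mulr_ge0// dramp_ge0. Qed.

Lemma continuous_dcutoff k : continuous (dcutoff k).
Proof.
move=> t; apply: cvgM; first exact: cvg_cst.
apply: continuous_cvg; first exact: continuous_dramp.
by apply: cvgB; [apply: cvgM; [exact: cvg_cst|exact: cvg_id]|exact: cvg_cst].
Qed.

End Cutoff.

(** * Measure and Green's formula in the plane *)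

Lemma countable_bigcup_measurable (T : countType) d (X : measurableType d)
    (I : set T) (B : T -> set X) :
  (forall k, I k -> measurable (B k)) -> measurable (\bigcup_(k in I) B k).
Proof.
move=> mB.
pose F n := if @unpickle T n is Some k
  then (if k \in I then B k else set0) else set0.
have -> : \bigcup_(k in I) B k = \bigcup_n F n.
  apply/seteqP; split=> [x [k Ik Bk]|x [n _]].
    by exists (pickle k) => //; rewrite /F pickleK ifT// inE.
  by rewrite /F; case: unpickle => // k; case: ifPn => // /set_mem Ik Bx; exists k.
apply: bigcupT_measurable => n; rewrite /F.
case: unpickle => [k|]; last exact: measurable0.
by case: ifPn => [/set_mem/mB //|_]; exact: measurable0.
Qed.

Section Measure.
Variable R : realType.
Local Notation RR := (measurableTypeR R * measurableTypeR R)%type.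
Notation mu := (@lebesgue_measure R).
Notation mu2 := (@lebesgue2 R).

(** An open set of the plane is the union of the rational boxes it contains,
    so it belongs to the product of the two Borel sigma-algebras, on which
    [lebesgue2] is defined. *)
Lemma open_measurable_prod (U : set (R * R)) : open U -> measurable (U : set RR).
Proof.
move=> oU.
pose B (c : rat * rat) : set R := ball (ratr c.1 : R) (ratr c.2).
pose I := [set k : (rat * rat) * (rat * rat) | B k.1 `*` B k.2 `<=` U].
have -> : U = \bigcup_(k in I) (B k.1 `*` B k.2).
  apply/seteqP; split=> [[a b] Uab|x [k Ik Bk]]; last exact: Ik.
  have [[P Q] /= [nP nQ] PQ] : nbhs (a, b) U by exact: open_nbhs_nbhs.
  have [c1 [r1 [xP BP]]] := open_subball_rat (@open_interior _ P) (mem_set nP).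
  have [c2 [r2 [xQ BQ]]] := open_subball_rat (@open_interior _ Q) (mem_set nQ).
  exists ((c1, r1), (c2, r2)).
    move=> [s t] [/= hs ht]; apply: PQ; split => /=.
      exact: interior_subset (BP _ hs).
    exact: interior_subset (BQ _ ht).
  by split; [exact: set_mem xP|exact: set_mem xQ].
apply: countable_bigcup_measurable => k _.
by apply: measurableX; apply: open_measurable; exact: ball_open.
Qed.

Lemma continuous_on_measurable (U : set (R * R)) (f : R * R -> R) : open U ->
  (forall x, U x -> {for x, continuous f}) -> measurable_fun (U : set RR) f.
Proof.
move=> oU cf mU; apply: (measurability _ (RGenOpens.measurableE R)); last exact: mU.
move=> _ [_ [a [b ->] <-]]; apply: open_measurable_prod.
rewrite openE => x [Ux fx]; apply: filterI; first exact: open_nbhs_nbhs.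
by apply: (cf x Ux); apply: open_nbhs_nbhs; split => //; exact: interval_open.
Qed.

Lemma set1_measurable_prod (x : R * R) : measurable ([set x] : set RR).
Proof.
case: x => a b; have -> : [set (a, b)] = [set a] `*` [set b].
  by apply/seteqP; split=> [_ ->//|[s t] [/= -> ->]].
by apply: measurableX; exact: measurable_set1.
Qed.

Lemma lebesgue2_set1 (x : R * R) : mu2 [set x] = 0%E.
Proof.
case: x => a b; have -> : [set (a, b)] = [set a] `*` [set b].
  by apply/seteqP; split=> [_ ->//|[s t] [/= -> ->]].
rewrite /lebesgue2 [LHS]product_measure1E; try exact: measurable_set1.
by rewrite /= lebesgue_measure_set1 mul0e.
Qed.

Lemma compact_bound (K : set (R * R)) (h : R * R -> R) : compact K ->
  (forall x, K x -> {for x, continuous h}) ->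
  exists B, forall x, K x -> `|h x| <= B.
Proof.
move=> cK ch; have ch' : {within K, continuous h}.
  by apply: continuous_in_subspaceT => x /set_mem; exact: ch.
have /compact_bounded[M [_ /(_ (M + 1))]] := continuous_compact ch' cK.
move=> /(_ (ltr_pwDr ltr01 (lexx _))) hM; exists (M + 1) => x Kx.
by apply: hM; exists x.
Qed.

Lemma slice_fst (f : R * R -> R) x y : {for (x, y), continuous f} ->
  {for x, continuous (fun t => f (t, y))}.
Proof.
move=> cf; apply: (@continuous_comp _ _ _ (fun t => (t, y)) f x) => //.
have h1 : (fun t : R => t) @ x --> x by exact: cvg_id.
have h2 : (fun t : R => y) @ x --> y by exact: cvg_cst.
exact: (cvg_pair h1 h2).
Qed.

Lemma slice_snd (f : R * R -> R) x y : {for (x, y), continuous f} ->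
  {for y, continuous (fun t => f (x, t))}.
Proof.
move=> cf; apply: (@continuous_comp _ _ _ (fun t => (x, t)) f y) => //.
have h1 : (fun t : R => t) @ y --> y by exact: cvg_id.
have h2 : (fun t : R => x) @ y --> x by exact: cvg_cst.
exact: (cvg_pair h2 h1).
Qed.

Section Rectangle.
Variables (a b c d : R) (D : set (R * R)).
Hypotheses (ab : a < b) (cd : c < d) (oD : open D).
Let A := [set` `[a, b]].
Let C := [set` `[c, d]].
Hypothesis (QD : A `*` C `<=` D).

Lemma rect_compact : compact (A `*` C).
Proof. by apply: compact_setX; exact: segment_compact. Qed.

Lemma rect_measurable : measurable (A `*` C : set RR).
Proof. by apply: measurableX; exact: measurable_itv. Qed.

Lemma rect_integrable (h : R * R -> R) :
  (forall x, D x -> {for x, continuous h}) ->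
  mu2.-integrable (A `*` C) (EFin \o h).
Proof.
move=> ch; apply: measurable_bounded_integrable.
- exact: rect_measurable.
- rewrite /lebesgue2 [ltLHS]product_measure1E; try exact: measurable_itv.
  rewrite /= !lebesgue_measure_itv /= !lte_fin ab cd.
  by rewrite -EFinB -EFinB -EFinM ltry.
- apply: (@measurable_funS _ _ _ _ (D : set RR)) => //.
    exact: open_measurable_prod.
  exact: continuous_on_measurable.
- have [B hB] := compact_bound rect_compact (fun x Qx => ch x (QD Qx)).
  exists B; split; first exact: num_real.
  by move=> M /ltW BM x /hB /le_trans; exact.
Qed.

End Rectangle.

Lemma FTC_segment (a b : R) (F f : R -> R) : a < b ->
  (forall t, t \in `[a, b] -> is_derive t 1 F (f t)) ->
  (forall t, t \in `[a, b] -> {for t, continuous f}) ->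
  (\int[mu]_(t in `[a, b]) (f t)%:E = (F b - F a)%:E)%E.
Proof.
move=> ab dF cf.
have cF t : t \in `[a, b] -> {for t, continuous F}.
  move=> /dF h; apply/differentiable_continuous/derivable1_diffP.
  exact: ex_derive.
have aE : a \in `[a, b] by rewrite in_itv/= lexx ltW.
have bE : b \in `[a, b] by rewrite in_itv/= lexx ltW.
rewrite EFinB; apply: continuous_FTC2 => //.
- by apply: continuous_in_subspaceT => t /set_mem; exact: cf.
- split.
  + by move=> t tab; have h := dF t (subset_itv_oo_cc tab); exact: ex_derive.
  + by apply: cvg_at_right_filter; exact: cF.
  + by apply: cvg_at_left_filter; exact: cF.
- move=> t tab; have h := dF t (subset_itv_oo_cc tab).
  by rewrite derive1E derive_val.
Qed.

Lemma int_diff_le (c d B : R) (g1 g2 : R -> R) : c < d ->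
  (forall t, t \in `[c, d] -> {for t, continuous g1}) ->
  (forall t, t \in `[c, d] -> {for t, continuous g2}) ->
  (forall t, t \in `[c, d] -> `|g1 t| <= B) ->
  (forall t, t \in `[c, d] -> `|g2 t| <= B) ->
  (\int[mu]_(t in `[c, d]) (g1 t - g2 t)%:E <= (2 * B * (d - c))%:E)%E.
Proof.
move=> cd c1 c2 b1 b2.
have -> : (2 * B * (d - c))%:E = (\int[mu]_(t in `[c, d]) (2 * B)%:E)%E.
  rewrite integral_cst//.
  by rewrite /= lebesgue_measure_itv /= lte_fin cd -EFinB -EFinM.
apply: le_integral.
- exact: measurable_itv.
- apply: continuous_compact_integrable; first exact: segment_compact.
  apply: continuous_in_subspaceT => t /set_mem tcd.
  by apply: cvgB; [exact: c1|exact: c2].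
- apply: continuous_compact_integrable; first exact: segment_compact.
  by apply: continuous_in_subspaceT => t _; exact: cvg_cst.
- move=> t; rewrite inE/= => tcd; rewrite lee_fin.
  have := b1 t tcd; have := b2 t tcd; rewrite !ler_norml.
  by move=> /andP[] ? ? /andP[] ? ?; lra.
Qed.

(** Half of Green's formula, in the form used below: the bound involves G only
    on the two vertical sides of the rectangle, never in its interior. *)
Lemma green_fst (a b c d B : R) (D : set (R * R)) (G g : R * R -> R) :
  a < b -> c < d -> open D -> [set` `[a, b]] `*` [set` `[c, d]] `<=` D ->
  (forall x, D x -> is_derive x (basis2 R 0) G (g x)) ->
  (forall x, D x -> {for x, continuous G}) ->
  (forall x, D x -> {for x, continuous g}) ->
  (forall y, y \in `[c, d] -> `|G (a, y)| <= B /\ `|G (b, y)| <= B) ->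
  (\int[mu2]_(x in [set` `[a, b]] `*` [set` `[c, d]]) (g x)%:E <=
   (2 * B * (d - c))%:E)%E.
Proof.
move=> ab cd oD QD dG cG cg GB.
have aE : a \in `[a, b] by rewrite in_itv/= lexx ltW.
have bE : b \in `[a, b] by rewrite in_itv/= lexx ltW.
set Q := _ `*` _ in QD *.
have mQ : measurable (Q : set RR) by exact: rect_measurable.
have ig : mu2.-integrable setT ((EFin \o g) \_ Q).
  have iQ := rect_integrable ab cd oD QD cg.
  exact: (iffLR (integrable_mkcond _ mQ) iQ).
rewrite integral_mkcond -integral21_prod_meas1//.
rewrite (_ : (fun y => _) = (fun y => (G (b, y) - G (a, y))%:E) \_ `[c, d]).
  rewrite -integral_mkcond; apply: int_diff_le => // y ycd.
  - by apply: slice_snd; apply/cG/QD.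
  - by apply: slice_snd; apply/cG/QD.
  - by have [] := GB y ycd.
  - by have [] := GB y ycd.
apply/funext => y; rewrite patchE; case: ifPn => [|] ycd.
  have {}ycd : y \in `[c, d] by rewrite inE in ycd.
  have hd t : t \in `[a, b] -> is_derive t 1 (fun t => G (t, y)) (g (t, y)).
    by move=> tab; apply/is_derive_fst/dG/QD.
  have hc t : t \in `[a, b] -> {for t, continuous (fun t => g (t, y))}.
    by move=> tab; apply: slice_fst; apply/cg/QD.
  rewrite -(@FTC_segment _ _ _ _ ab hd hc).
  rewrite integral_mkcond; apply: eq_integral => x _.
  rewrite !patchE; congr (if _ then _ else _).
  by apply/idP/idP; rewrite !inE /Q /=; [case|].
apply: integral0_eq => x _; rewrite patchE ifN//.
by apply: contra ycd; rewrite !inE /Q /= => -[].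
Qed.

Lemma green_snd (a b c d B : R) (D : set (R * R)) (G g : R * R -> R) :
  a < b -> c < d -> open D -> [set` `[a, b]] `*` [set` `[c, d]] `<=` D ->
  (forall x, D x -> is_derive x (basis2 R 1) G (g x)) ->
  (forall x, D x -> {for x, continuous G}) ->
  (forall x, D x -> {for x, continuous g}) ->
  (forall x, x \in `[a, b] -> `|G (x, c)| <= B /\ `|G (x, d)| <= B) ->
  (\int[mu2]_(x in [set` `[a, b]] `*` [set` `[c, d]]) (g x)%:E <=
   (2 * B * (b - a))%:E)%E.
Proof.
move=> ab cd oD QD dG cG cg GB.
have cE : c \in `[c, d] by rewrite in_itv/= lexx ltW.
have dE : d \in `[c, d] by rewrite in_itv/= lexx ltW.
set Q := _ `*` _ in QD *.
have mQ : measurable (Q : set RR) by exact: rect_measurable.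
have ig : mu2.-integrable setT ((EFin \o g) \_ Q).
  have iQ := rect_integrable ab cd oD QD cg.
  exact: (iffLR (integrable_mkcond _ mQ) iQ).
rewrite integral_mkcond -integral12_prod_meas1//.
rewrite (_ : (fun x => _) = (fun x => (G (x, d) - G (x, c))%:E) \_ `[a, b]).
  rewrite -integral_mkcond; apply: int_diff_le => // x xab.
  - by apply: slice_fst; apply/cG/QD.
  - by apply: slice_fst; apply/cG/QD.
  - by have [] := GB x xab.
  - by have [] := GB x xab.
apply/funext => x; rewrite patchE; case: ifPn => [|] xab.
  have {}xab : x \in `[a, b] by rewrite inE in xab.
  have hd t : t \in `[c, d] -> is_derive t 1 (fun t => G (x, t)) (g (x, t)).
    by move=> tcd; apply/is_derive_snd/dG/QD.
  have hc t : t \in `[c, d] -> {for t, continuous (fun t => g (x, t))}.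
    by move=> tcd; apply: slice_snd; apply/cg/QD.
  rewrite -(@FTC_segment _ _ _ _ cd hd hc).
  rewrite integral_mkcond; apply: eq_integral => y _.
  rewrite !patchE; congr (if _ then _ else _).
  by apply/idP/idP; rewrite !inE /Q /=; [case|].
apply: integral0_eq => y _; rewrite patchE ifN//.
by apply: contra xab; rewrite !inE /Q /= => -[].
Qed.

Lemma derive_neq_near (k : R -> R) (b d : R) : is_derive b 1 k d -> d != 0 ->
  \forall h \near 0^', k (h + b) != k b.
Proof.
move=> [ex dE] d0.
have cv : h^-1 *: (k (h *: (1 : R) + b) - k b) @[h --> 0^'] --> d.
  by rewrite -dE; exact: ex.
near=> h; apply/eqP => kE.
have : `|d - h^-1 *: (k (h *: 1 + b) - k b)| < `|d|.
  near: h; move/cvgrPdist_lt : cv; apply.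
  by rewrite normr_gt0.
by rewrite [h *: 1]mulr1 kE subrr scaler0 subr0 ltxx.
Unshelve. all: by end_near. Qed.

(** By Fubini it suffices that vertical slices are null; their points are
    isolated in the slice, and a set of isolated reals is countable. *)
Lemma zero_set_null (U : set (R * R)) (s : R * R -> R) : open U ->
  (forall x, U x -> {for x, continuous s}) ->
  (forall a b, U (a, b) -> s (a, b) = 0 ->
     \forall h \near 0^', s (a, h + b) != 0) ->
  measurable (U `&` s @^-1` [set 0] : set RR) /\
  mu2 (U `&` s @^-1` [set 0]) = 0%E.
Proof.
move=> oU cs iso; split.
  apply: (continuous_on_measurable oU cs); first exact: open_measurable_prod.
  exact: measurable_set1.
rewrite /lebesgue2 /= /product_measure1; apply: integral0_eq => a _ /=.
apply: countable_lebesgue_measure0.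
apply: sub_countable (countable_isolated (xsection (U `&` s @^-1` [set 0]) a)).
apply: subset_card_le => b; rewrite /xsection/= inE => -[Uab sab].
split; first by apply/mem_set => /=; apply/mem_set.
have [e /= e0 he] := iso a b Uab sab.
exists (ball b e); first exact: nbhsx_ballx.
apply/seteqP; split=> [t [bt]|_ ->].
  move=> /set_mem[_ /= st]; apply/eqP; apply: contraT => tb.
  have := he (t - b); rewrite /ball_/= sub0r normrN subr_eq0 subrK st eqxx.
  by move=> /(_ _ tb); apply; rewrite distrC.
by split; [exact: ballxx|apply/mem_set].
Qed.

End Measure.

(** * Vector algebra in dimension three *)

Section Vectors.
Variable R : realType.
Implicit Types a b c d u v w : 'rV[R]_3.

(** 1 + 1 is the third index, as in the definition of [crossp]. *)
Lemma dotpE u v :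
  dotp u v = u 0 0 * v 0 0 + u 0 1 * v 0 1 + u 0 (1 + 1) * v 0 (1 + 1).
Proof.
rewrite /dotp !big_ord_recl big_ord0 addr0 addrA.
have -> : lift ord0 ord0 = 1 :> 'I_3 by apply/val_inj.
by have -> : lift ord0 (lift ord0 ord0) = 1 + 1 :> 'I_3 by apply/val_inj.
Qed.

Lemma crosspE u v :
  [/\ crossp u v 0 0 = u 0 1 * v 0 (1 + 1) - u 0 (1 + 1) * v 0 1,
      crossp u v 0 1 = u 0 (1 + 1) * v 0 0 - u 0 0 * v 0 (1 + 1)
    & crossp u v 0 (1 + 1) = u 0 0 * v 0 1 - u 0 1 * v 0 0].
Proof.
have I3 : (1 + 1 + 1 = 0 :> 'I_3) by apply/val_inj.
by split; rewrite mxE ?add0r ?I3 ?add0r.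
Qed.

Lemma row3P u v : u 0 0 = v 0 0 -> u 0 1 = v 0 1 ->
  u 0 (1 + 1) = v 0 (1 + 1) -> u = v.
Proof.
move=> h0 h1 h2; apply/rowP => -[[|[|[|//]]] j].
- by rewrite (_ : Ordinal j = 0)//; exact/val_inj.
- by rewrite (_ : Ordinal j = 1)//; exact/val_inj.
- by rewrite (_ : Ordinal j = 1 + 1)//; exact/val_inj.
Qed.

Lemma dotpC u v : dotp u v = dotp v u.
Proof. by apply: eq_bigr => k _; rewrite mulrC. Qed.

Lemma dotpDl u v w : dotp (u + v) w = dotp u w + dotp v w.
Proof. by rewrite !dotpE !mxE; ring. Qed.

Lemma dotpZl (k : R) u v : dotp (k *: u) v = k * dotp u v.
Proof. by rewrite !dotpE !mxE; ring. Qed.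

Lemma dotpDr u v w : dotp w (u + v) = dotp w u + dotp w v.
Proof. by rewrite !(dotpC w) dotpDl. Qed.

Lemma dotpZr (k : R) u v : dotp u (k *: v) = k * dotp u v.
Proof. by rewrite !(dotpC u) dotpZl. Qed.

Lemma dotp_ge0 u : 0 <= dotp u u.
Proof. by apply: sumr_ge0 => k _; rewrite -expr2 sqr_ge0. Qed.

Lemma dotp_eq0 u : dotp u u = 0 -> u = 0.
Proof.
move=> /eqP; rewrite /dotp psumr_eq0; last by move=> k _; rewrite -expr2 sqr_ge0.
move=> /allP H; apply/rowP => k; rewrite mxE; apply/eqP.
by have := H k (mem_index_enum _); rewrite mulf_eq0 orbb.
Qed.

Lemma dotp_gt0 u : u != 0 -> 0 < dotp u u.
Proof.
move=> u0; rewrite lt_def dotp_ge0 andbT.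
by apply: contra_neq u0; exact: dotp_eq0.
Qed.

Lemma dotp_crossp a b c d :
  dotp (crossp a b) (crossp c d) = dotp a c * dotp b d - dotp a d * dotp b c.
Proof.
rewrite !dotpE; have [-> -> ->] := crosspE a b; have [-> -> ->] := crosspE c d.
by ring.
Qed.

Lemma dotp_crossp_rot a b c : dotp a (crossp b c) = dotp b (crossp c a).
Proof.
rewrite !dotpE; have [-> -> ->] := crosspE b c; have [-> -> ->] := crosspE c a.
by ring.
Qed.

Lemma crossp_crossp a b c :
  crossp a (crossp b c) = dotp a c *: b - dotp a b *: c.
Proof.
have [h1 h2 h3] := crosspE a (crossp b c); have [g1 g2 g3] := crosspE b c.
by apply: row3P; rewrite ?h1 ?h2 ?h3 ?g1 ?g2 ?g3 !mxE !dotpE; ring.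
Qed.

Lemma dotp_crossp_l a b : dotp a (crossp a b) = 0.
Proof. by rewrite dotpE; have [-> -> ->] := crosspE a b; ring. Qed.

Lemma dotp_crossp_r a b : dotp b (crossp a b) = 0.
Proof. by rewrite dotpE; have [-> -> ->] := crosspE a b; ring. Qed.

Lemma dotp_le_half a b : `|dotp a b| <= (dotp a a + dotp b b) / 2.
Proof.
have h1 := dotp_ge0 (a + b); have h2 := dotp_ge0 (a + -1 *: b).
rewrite !dotpDl !dotpDr ?dotpZl ?dotpZr (dotpC b a) in h1 h2.
by rewrite ler_norml; apply/andP; split; lra.
Qed.

Lemma gram_comb a b : dotp a a * dotp b b - dotp a b * dotp a b = 0 ->
  dotp b b *: a + (- dotp a b) *: b = 0.
Proof.
move=> D0; apply: dotp_eq0.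
rewrite dotpDl !dotpDr !dotpZl !dotpZr (dotpC b a).
transitivity (dotp b b * (dotp a a * dotp b b - dotp a b * dotp a b)).
  by ring.
by rewrite D0 mulr0.
Qed.

End Vectors.

Section Weingarten.
Variable R : realType.
Variables (u v n nu nv X : 'rV[R]_3) (W e f g : R).
Hypotheses (W0 : W != 0) (nW : W *: n = crossp u v) (nn : dotp n n = 1).
Hypotheses (nnu : dotp n nu = 0) (nnv : dotp n nv = 0).
Hypotheses (uu : dotp nu u = - e) (uv : dotp nu v = - f).
Hypotheses (vu : dotp nv u = - f) (vv : dotp nv v = - g).

(** With u, v the coordinate vectors, nu, nv the derivatives of the normal n
    and u x v = W n, triple products with n become products of two cross
    products, which Lagrange's identity evaluates.  Divided by W, the right-hand
    side is 2 H W. *)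
Lemma flux_mean :
  W * (dotp u (crossp n nv) - dotp v (crossp n nu)) =
  e * dotp v v - 2 * f * dotp u v + g * dotp u u.
Proof.
rewrite (dotp_crossp_rot u) (dotp_crossp_rot v) mulrBr -!(dotpZl W) nW !dotp_crossp.
by rewrite (dotpC u nv) (dotpC v nv) (dotpC v nu) (dotpC u nu) uu uv vu vv
  (dotpC v u); ring.
Qed.

(** Both nu and nv are orthogonal to n, so nu x nv is a multiple of n, with
    coefficient (e g - f^2) / W, that is, K W. *)
Lemma flux_gauss :
  W * dotp X (crossp nu nv) = (e * g - f ^+ 2) * dotp X n.
Proof.
have : dotp (crossp n X) (crossp n (crossp nu nv)) = 0.
  rewrite crossp_crossp nnu nnv !scale0r subrr dotpC.
  by rewrite -(scale0r n) dotpZl mul0r.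
rewrite dotp_crossp nn mul1r => /eqP; rewrite subr_eq0 => /eqP ->.
rewrite mulrA -(dotpZl W) nW dotp_crossp.
by rewrite (dotpC u nv) (dotpC v nv) (dotpC v nu) (dotpC u nu) uu uv vu vv
  (dotpC X n); ring.
Qed.

(** The curl of the flux form <X, N x dN>.  The mixed derivative nuv of the
    normal occurs in both products and cancels. *)
Lemma flux_total (nuv : 'rV[R]_3) : e * g - f ^+ 2 = W ^+ 2 ->
  dotp u (crossp n nv) + (dotp X (crossp nu nv) + dotp X (crossp n nuv)) -
  (dotp v (crossp n nu) + (dotp X (crossp nv nu) + dotp X (crossp n nuv))) =
  (e * dotp v v - 2 * f * dotp u v + g * dotp u u) / W + 2 * W * dotp X n.
Proof.
move=> K1.
have -> : crossp nv nu = -1 *: crossp nu nv.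
  by apply/rowP => k; rewrite !mxE; ring.
have h : dotp X (crossp nu nv) = W * dotp X n.
  by apply: (mulfI W0); rewrite flux_gauss K1; ring.
by rewrite dotpZr h -flux_mean; field.
Qed.

(** The wedge of ds, where s = |X|^2 / 2, with the flux form is the second
    form evaluated on the tangent vector n x X, whose coordinates are -b / W and
    a / W; hence the quadratic expression on the right. *)
Lemma flux_radial : let a := dotp X u in let b := dotp X v in
  W * (a * dotp X (crossp n nv) - b * dotp X (crossp n nu)) =
  a ^+ 2 * g - 2 * a * b * f + b ^+ 2 * e.
Proof.
move=> a b.
have E : W *: crossp X n = b *: u - a *: v.
  rewrite -crossp_crossp -nW.
  have [h1 h2 h3] := crosspE X (W *: n); have [g1 g2 g3] := crosspE X n.
  by apply: row3P; rewrite ?h1 ?h2 ?h3 [LHS]mxE ?g1 ?g2 ?g3 !mxE; ring.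
have rot c : W * dotp X (crossp n c) = b * dotp c u - a * dotp c v.
  rewrite (dotp_crossp_rot X) (dotp_crossp_rot n) -dotpZr E dotpDr dotpZr.
  by rewrite -scaleNr dotpZr; ring.
rewrite mulrBr !(mulrCA W) !rot uu uv vu vv; ring.
Qed.

End Weingarten.

Section Unfolding.
Variable R : realType.

Lemma unit_normalE (psi : R * R -> 'rV[R]_3) x : unit_normal psi x =
  (Num.sqrt (dotp (crossp (partial 0 psi x) (partial 1 psi x))
    (crossp (partial 0 psi x) (partial 1 psi x))))^-1 *:
  crossp (partial 0 psi x) (partial 1 psi x).
Proof. by []. Qed.

Lemma area_densityE (psi : R * R -> 'rV[R]_3) x :
  area_density psi x = Num.sqrt (\det (first_form psi x)).
Proof. by []. Qed.
End Unfolding.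

Section Forms.
Variable R : realType.

(** As e g - f^2 > 0, the quadratic form has the sign of e or is zero.  The sign
    of e is also that of the trace of the second form against the first, the first
    being positive definite.  Both
    claims follow by completing the square after multiplication by e. *)
Lemma definite_sign (E F G e f g a b : R) :
  0 < E -> 0 < E * G - F ^+ 2 -> 0 < e * g - f ^+ 2 ->
  0 <= Num.sg (e * G - 2 * f * F + g * E) *
       (a ^+ 2 * g - 2 * a * b * f + b ^+ 2 * e).
Proof.
move=> E0 D0 K0.
set T := e * G - 2 * f * F + g * E; set q := a ^+ 2 * g - _ + _.
have eq0 : 0 <= e * q.
  have -> : e * q = (b * e - a * f) ^+ 2 + a ^+ 2 * (e * g - f ^+ 2).
    by rewrite /q; ring.
  by rewrite addr_ge0 ?sqr_ge0// mulr_ge0 ?sqr_ge0// ltW.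
have eT0 : 0 < e * T.
  have : 0 < E * (e * T).
    have -> : E * (e * T) = e ^+ 2 * (E * G - F ^+ 2) + (e * F - f * E) ^+ 2
      + E ^+ 2 * (e * g - f ^+ 2) by rewrite /T; ring.
    have E20 : 0 < E ^+ 2 by rewrite exprn_gt0.
    apply: ltr_wpDl; last exact: mulr_gt0.
    by apply: addr_ge0; rewrite ?sqr_ge0// mulr_ge0 ?sqr_ge0 ?(ltW D0).
  by rewrite pmulr_rgt0.
have [T0|T0|T0] := ltgtP T 0.
- rewrite (ltr0_sg T0) mulN1r oppr_ge0.
  by rewrite nmulr_lgt0// in eT0; rewrite nmulr_rge0 in eq0.
- rewrite gtr0_sg// mul1r.
  by rewrite pmulr_lgt0// in eT0; rewrite pmulr_rge0 in eq0.
- by rewrite T0 mulr0 ltxx in eT0.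
Qed.

(** H^2 >= K without diagonalising: after multiplication by E^2 the difference
    is a sum of two squares with nonnegative coefficients. *)
Lemma gauss_le_mean_sqr (E F G e f g : R) : 0 < E ->
  0 < E * G - F ^+ 2 ->
  4 * (E * G - F ^+ 2) * (e * g - f ^+ 2) <= (e * G - 2 * f * F + g * E) ^+ 2.
Proof.
move=> E0 D0; rewrite -subr_ge0.
have : 0 <= E ^+ 2 * ((e * G - 2 * f * F + g * E) ^+ 2 -
  4 * (E * G - F ^+ 2) * (e * g - f ^+ 2)).
  have -> : E ^+ 2 * ((e * G - 2 * f * F + g * E) ^+ 2 -
    4 * (E * G - F ^+ 2) * (e * g - f ^+ 2)) =
    (E * (E * g - G * e) - 2 * F * (E * f - F * e)) ^+ 2 +
     4 * (E * G - F ^+ 2) * (E * f - F * e) ^+ 2 by ring.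
  apply: addr_ge0; first exact: sqr_ge0.
  by apply: mulr_ge0 (sqr_ge0 _); apply: mulr_ge0 => //; exact: ltW.
by rewrite pmulr_rge0// exprn_gt0.
Qed.

(** The pointwise inequality behind the weighted Minkowski formula, with t and
    dt the values of the weight and of its derivative, a0 and a1 the derivatives
    of s, b0 and b1 the flux form, d01 - d10 its curl and Y = <X, N>.  The term in
    dt is nonnegative and is dropped. *)
Lemma flow_ineq (t dt H W a0 a1 b0 b1 d01 d10 M Y : R) :
  0 <= t <= 1 -> 0 <= dt -> 0 < W -> `|Y| <= M ->
  0 <= Num.sg H * (a0 * b1 - a1 * b0) ->
  d01 - d10 = 2 * H * W + 2 * W * Y ->
  2 * t * `|H| * W <=
  dt * a0 * (Num.sg H * b1) + t * (Num.sg H * d01) -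
  (dt * a1 * (Num.sg H * b0) + t * (Num.sg H * d10)) + 2 * M * W.
Proof.
move=> /andP[t0 t1] dt0 W0 YM r0 dE.
have -> : dt * a0 * (Num.sg H * b1) + t * (Num.sg H * d01) -
  (dt * a1 * (Num.sg H * b0) + t * (Num.sg H * d10)) =
  dt * (Num.sg H * (a0 * b1 - a1 * b0)) + t * Num.sg H * (d01 - d10) by ring.
rewrite dE (mulrDr (t * Num.sg H)) (_ : t * _ * (2 * H * W) = 2 * t * (Num.sg H * H) * W);
  last by ring.
rewrite -normrEsg; have {}r0 := mulr_ge0 dt0 r0.
have : `|t * Num.sg H * (2 * W * Y)| <= 2 * M * W.
  rewrite !normrM (ger0_norm t0) normr_sg (gtr0_norm W0) (@ger0_norm _ 2)//.
  have -> : 2 * M * W = 1 * (2 * W * M) by ring.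
  apply: ler_pM; rewrite ?mulr_ge0//; try exact: ltW; last first.
    by rewrite ler_pM2l// mulr_gt0.
  by rewrite -[leRHS]mulr1 ler_pM//; case: (H != 0).
by rewrite ler_norml => /andP[h1 _]; lra.
Qed.

Lemma det_mx2 (M : 'M[R]_2) : \det M = M 0 0 * M 1 1 - M 0 1 * M 1 0.
Proof.
rewrite (expand_det_row _ 0) !big_ord_recl big_ord0 addr0 /cofactor !det_mx11.
have -> : lift ord0 ord0 = 1 :> 'I_2 by apply/val_inj.
rewrite !mxE /= expr0 expr1 mul1r mulN1r.
have -> : lift 0 0 = 1 :> 'I_2 by apply/val_inj.
have -> : lift 1 0 = 0 :> 'I_2 by apply/val_inj.
by rewrite mulrN.
Qed.

Lemma trace_invmx2 (A B : 'M[R]_2) : \det A != 0 ->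
  \tr (invmx A *m B) =
  (A 1 1 * B 0 0 - A 0 1 * B 1 0 + A 0 0 * B 1 1 - A 1 0 * B 0 1) / \det A.
Proof.
move=> A0; have Au : A \in unitmx by rewrite unitmxE unitfE.
set S := invmx A *m B.
have AS i j : B i j = A i 0 * S 0 j + A i 1 * S 1 j.
  have -> : B = A *m S by rewrite mulKVmx.
  rewrite mxE !big_ord_recl big_ord0 addr0.
  by have -> : lift ord0 ord0 = 1 :> 'I_2 by apply/val_inj.
rewrite /mxtrace !big_ord_recl big_ord0 addr0.
have -> : lift ord0 ord0 = 1 :> 'I_2 by apply/val_inj.
apply: (mulIf A0); rewrite divfK// !AS det_mx2; ring.
Qed.

Lemma det_invmx2 (A B : 'M[R]_2) : \det (invmx A *m B) = \det B / \det A.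
Proof. by rewrite det_mulmx det_inv mulrC. Qed.

End Forms.

(** * First and second forms of a surface of curvature one *)

(* The indices 0 and 1 of the coordinates are slow to tell apart by computation;
   opacity keeps the comparison of partial derivatives with different indices from
   unfolding limits. *)
#[local] Opaque partial pd unit_normal area_density.

Definition first_E (R : realType) (psi : R * R -> 'rV[R]_3) x :=
  dotp (partial 0 psi x) (partial 0 psi x).
Definition first_F (R : realType) (psi : R * R -> 'rV[R]_3) x :=
  dotp (partial 0 psi x) (partial 1 psi x).
Definition first_G (R : realType) (psi : R * R -> 'rV[R]_3) x :=
  dotp (partial 1 psi x) (partial 1 psi x).
(** The numerator of the mean curvature: H = mean_num / (2 (E G - F^2)). *)
Definition mean_num (R : realType) (psi : R * R -> 'rV[R]_3) x :=
  second_form psi x 0 0 * first_G psi x -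
  2 * second_form psi x 0 1 * first_F psi x +
  second_form psi x 1 1 * first_E psi x.

Section Geometry.
Variable R : realType.
Implicit Types (U : set (R * R)) (F : R * R -> 'rV[R]_3).

Lemma partial_coord k U F i j x : Ckv k.+1 U F -> U x ->
  partial i F x 0 j = pd i (fun y => F y 0 j) x.
Proof.
move=> CF Ux; by have /is_derive_row/(_ j)/pdE := Ckv_derive i CF Ux.
Qed.

Lemma partialC U F x : open U -> Ckv 2 U F -> U x ->
  partial 1 (partial 0 F) x = partial 0 (partial 1 F) x.
Proof.
move=> oU CF Ux; apply/rowP => j.
have E a b : partial a (partial b F) x 0 j =
    pd a (pd b (fun y => F y 0 j)) x.
  rewrite (partial_coord _ _ (Ckv_partial b oU CF) Ux).
  by apply/near_eq_derive/(near_open oU) => // y /(partial_coord b j CF).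
apply: etrans (E 1 0) _; apply: etrans _ (esym (E 0 1)).
exact: (schwarz oU (CF j) Ux).
Qed.

Variables (U : set (R * R)) (psi : R * R -> 'rV[R]_3).
Hypotheses (oU : open U) (hK : K_surface U psi).

Let w x := crossp (partial 0 psi x) (partial 1 psi x).
Local Notation N := (unit_normal psi).
Local Notation W := (area_density psi).

Lemma Ckv_surface k : Ckv k U psi.
Proof. by apply: Ck_Ckv => //; case: hK => -[]. Qed.

Lemma is_derive_surface i x : U x ->
  is_derive x (basis2 R i) psi (partial i psi x).
Proof. exact: (Ckv_derive i (Ckv_surface 1)). Qed.

(** If the cross product of the coordinate vectors vanished, the Gram
    determinant E G - F^2 would vanish too, and the differential would kill
    (G, - F), or (0, 1) when G = 0. *)
Lemma crossp_partials_gt0 x : U x -> 0 < dotp (w x) (w x).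
Proof.
move=> Ux; apply: dotp_gt0; apply/eqP => w0.
have [[sm inj] _] := hK.
have dpsi : differentiable psi x by have [+ _] := sm 1%N; exact.
have dE i : 'd psi x (basis2 R i) = partial i psi x by rewrite partialE deriveE.
have d0 : 'd psi x 0 = 0 by rewrite linear0.
set a := partial 0 psi x; set b := partial 1 psi x.
have := dotp_crossp a b a b; rewrite -/(w x) w0 {1}/dotp big1; last first.
  by move=> k _; rewrite mxE mul0r.
rewrite (dotpC b a) => /esym D0.
have bb : dotp b b = 0.
  have : 'd psi x (dotp b b *: basis2 R 0 + (- dotp a b) *: basis2 R 1) =
      'd psi x 0.
    rewrite d0 linearD !linearZ /= !dE -/a -/b.
    by apply: gram_comb; rewrite D0.
  move=> /(inj x Ux)/(congr1 fst) /=.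
  by rewrite scaler0 addr0 [_ *: _]mulr1.
have : 'd psi x (basis2 R 1) = 'd psi x 0.
  by rewrite d0 dE; exact: dotp_eq0.
move=> /(inj x Ux)/(congr1 snd) /= /eqP.
by rewrite oner_eq0.
Qed.

Lemma area_density_cross x : W x = Num.sqrt (dotp (w x) (w x)).
Proof. by rewrite area_densityE det_mx2 !mxE dotp_crossp. Qed.

Lemma area_density_gt0 x : U x -> 0 < W x.
Proof. by move=> /crossp_partials_gt0 h; rewrite area_density_cross sqrtr_gt0. Qed.

Lemma scale_normal x : U x -> W x *: N x = w x.
Proof.
move=> Ux; rewrite unit_normalE -/(w x) -area_density_cross scalerA divff ?scale1r//.
by rewrite gt_eqF// area_density_gt0.
Qed.

Lemma Ckv_crossp_partials k : Ckv k U w.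
Proof. by apply: Ckv_crossp => //; exact/Ckv_partial/Ckv_surface. Qed.

Lemma Cks_area_inv k : Cks k U (fun x => (W x)^-1).
Proof.
apply: (@Cks_ext _ _ _ (fun x => (Num.sqrt (dotp (w x) (w x)))^-1)) => //.
  by move=> x _; rewrite area_density_cross.
by apply: Cks_rsqrt => //; [exact: crossp_partials_gt0|apply: Ckv_dotp => //; exact: Ckv_crossp_partials].
Qed.

Lemma Ckv_normal k : Ckv k U N.
Proof.
apply: (@Ckv_ext _ _ _ (fun x => (W x)^-1 *: w x)) => //.
  by move=> x _; rewrite area_density_cross unit_normalE.
by apply: Ckv_scale => //; [exact: Cks_area_inv|exact: Ckv_crossp_partials].
Qed.

Lemma normal_unit x : U x -> dotp (N x) (N x) = 1.
Proof.
move=> Ux; have W0 := area_density_gt0 Ux.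
have : W x ^+ 2 * dotp (N x) (N x) = W x ^+ 2.
  rewrite expr2 -mulrA -dotpZl -dotpZr scale_normal// -expr2 area_density_cross sqr_sqrtr//.
  exact: dotp_ge0.
by move=> /(canRL (mulKf _)) ->; rewrite ?mulVf ?expf_neq0// gt_eqF.
Qed.

Lemma normal_tangent i x : U x -> dotp (N x) (partial i psi x) = 0.
Proof.
move=> Ux; apply/eqP; have /gt_eqF W0 := area_density_gt0 Ux.
have : W x * dotp (N x) (partial i psi x) == 0.
  rewrite -dotpZl scale_normal// dotpC /w.
  have /orP[/eqP ->|/eqP ->] : (i == 0) || (i == 1) by case: i => -[|[]].
    by rewrite dotp_crossp_l.
  by rewrite dotp_crossp_r.
by rewrite mulf_eq0 W0.
Qed.

Lemma is_derive_normal i x : U x -> is_derive x (basis2 R i) N (partial i N x).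
Proof. exact: (Ckv_derive i (Ckv_normal 1)). Qed.

Lemma derive_const_on (f : R * R -> R) (c df : R) i x : U x ->
  (forall y, U y -> f y = c) -> is_derive x (basis2 R i) f df -> df = 0.
Proof.
move=> Ux fc h; rewrite -(@derive_val _ _ _ _ _ _ _ h).
rewrite (@near_eq_derive _ _ _ f (cst c)) ?derive_cst//.
exact: (near_open oU fc).
Qed.

Lemma normal_dnormal i x : U x -> dotp (N x) (partial i N x) = 0.
Proof.
move=> Ux; have hN := is_derive_normal i Ux.
have := derive_const_on Ux normal_unit (is_derive_dotp hN hN).
by rewrite (dotpC (partial i N x)) -mulr2n => /eqP; rewrite mulrn_eq0 => /eqP.
Qed.

(** Obtained by differentiating <N, d_j psi> = 0. *)
Lemma dnormal_tangent i j x : U x -> dotp (partial i N x) (partial j psi x) =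
  - second_form psi x i j.
Proof.
move=> Ux; have hN := is_derive_normal i Ux.
have hp := Ckv_derive i (Ckv_partial j oU (Ckv_surface 2)) Ux.
have /eqP := derive_const_on Ux (normal_tangent j) (is_derive_dotp hN hp).
by rewrite addr_eq0 mxE => /eqP ->; rewrite dotpC.
Qed.

Lemma second_form_sym x : U x -> second_form psi x 1 0 = second_form psi x 0 1.
Proof. by move=> Ux; rewrite !mxE (partialC oU (Ckv_surface 2) Ux). Qed.

Local Notation e x := (second_form psi x 0 0).
Local Notation f x := (second_form psi x 0 1).
Local Notation g x := (second_form psi x 1 1).
Local Notation E := (first_E psi).
Local Notation F := (first_F psi).
Local Notation G := (first_G psi).
Local Notation T := (mean_num psi).

Lemma area_density_sqr x : W x ^+ 2 = E x * G x - F x ^+ 2.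
Proof.
rewrite area_density_cross sqr_sqrtr ?dotp_ge0// dotp_crossp expr2.
by rewrite (dotpC (partial 1 psi x) (partial 0 psi x)).
Qed.

Lemma det_first_form x : \det (first_form psi x) = W x ^+ 2.
Proof.
by rewrite area_density_sqr det_mx2 !mxE expr2 (dotpC (partial 1 psi x) (partial 0 psi x)).
Qed.

Lemma det_second_form x : U x -> e x * g x - f x ^+ 2 = W x ^+ 2.
Proof.
move=> Ux; have [_ /(_ x Ux)] := hK.
have W20 : W x ^+ 2 != 0 by rewrite expf_neq0// gt_eqF// area_density_gt0.
rewrite /gauss_curvature /shape_operator det_invmx2 det_first_form.
by move=> /(canRL (divfK W20)); rewrite mul1r det_mx2 second_form_sym.
Qed.

Lemma mean_curvatureE x : U x -> mean_curvature psi x = T x / (2 * W x ^+ 2).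
Proof.
move=> Ux; have W20 : W x ^+ 2 != 0 by rewrite expf_neq0// gt_eqF// area_density_gt0.
rewrite /mean_curvature /shape_operator trace_invmx2 ?det_first_form//.
have ffE i j : first_form psi x i j = dotp (partial i psi x) (partial j psi x).
  by rewrite mxE.
rewrite second_form_sym// !ffE (dotpC (partial 1 psi x) (partial 0 psi x)).
rewrite -/(first_E psi x) -/(first_F psi x) -/(first_G psi x) /mean_num.
move: (e x) (f x) (g x) (E x) (F x) (G x) (W x) W20 => e' f' g' E' F' G' W' W20.
by field; rewrite -sqrf_eq0.
Qed.

End Geometry.

(** * The flux form and its weighted versions *)

#[local] Opaque crossp dotp mean_curvature second_form.

Section Flux.
Variable R : realType.
Variables (U : set (R * R)) (psi : R * R -> 'rV[R]_3).
Hypotheses (oU : open U) (hK : K_surface U psi).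

Local Notation N := (unit_normal psi).
Local Notation W := (area_density psi).
Local Notation H := (mean_curvature psi).
Local Notation e x := (second_form psi x 0 0).
Local Notation f x := (second_form psi x 0 1).
Local Notation g x := (second_form psi x 1 1).
Local Notation E := (first_E psi).
Local Notation F := (first_F psi).
Local Notation G := (first_G psi).
Local Notation T := (mean_num psi).

Lemma first_E_gt0 x : U x -> 0 < E x.
Proof.
move=> Ux; rewrite lt_def dotp_ge0 andbT; apply/eqP => E0.
have := area_density_sqr psi x; rewrite E0 mul0r sub0r => W2.
have : 0 < area_density psi x ^+ 2 by rewrite exprn_gt0// (area_density_gt0 hK Ux).
by rewrite W2 oppr_gt0 ltNge sqr_ge0.
Qed.

Lemma mean_curvature_ge1 x : U x -> 1 <= `|H x|.
Proof.
move=> Ux; have W0 := area_density_gt0 hK Ux.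
have W20 : 0 < W x ^+ 2 by rewrite exprn_gt0.
have D0 : 0 < E x * G x - F x ^+ 2 by rewrite -area_density_sqr.
have hT := gauss_le_mean_sqr (e x) (f x) (g x) (first_E_gt0 Ux) D0.
rewrite -area_density_sqr (det_second_form oU hK Ux) -/(T x) in hT.
rewrite (mean_curvatureE oU hK Ux) normrM normfV.
rewrite ler_pdivlMr ?normr_gt0 ?mulf_neq0 ?gt_eqF// mul1r.
rewrite -ler_sqr ?nnegrE// !real_normK ?num_real//.
by apply: le_trans hT; rewrite exprMn; lra.
Qed.

Lemma Cks_second_form i j k : Cks k U (fun x => second_form psi x i j).
Proof.
apply: (@Cks_ext _ _ _ (fun x => dotp (partial i (partial j psi) x) (N x))) => //.
  by move=> x _; rewrite mxE.
apply: Ckv_dotp => //; last exact: Ckv_normal.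
by do 2 apply: Ckv_partial => //; exact: Ckv_surface.
Qed.

Lemma Cks_first_form i j k : Cks k U (fun x => dotp (partial i psi x) (partial j psi x)).
Proof. by apply: Ckv_dotp => //; apply: Ckv_partial => //; exact: Ckv_surface. Qed.

Lemma Cks_mean k : Cks k U H.
Proof.
apply: (@Cks_ext _ _ _ (fun x => (2^-1 * ((W x)^-1 * (W x)^-1)) *
   (e x * G x - 2 * f x * F x + g x * E x))) => //.
  move=> x Ux; rewrite (mean_curvatureE oU hK Ux).
  by rewrite /mean_num invfM -exprVn expr2; ring.
have W1 := Cks_area_inv oU hK k; have c c := @Cks_cst R k U c oU.
apply: Cks_mul => //; first by apply: Cks_mul => //; apply: Cks_mul.
apply: Cks_add => //; last by apply: Cks_mul => //; [exact: Cks_second_form|exact: Cks_first_form].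
apply: Cks_sub => //; apply: Cks_mul => //; try exact: Cks_first_form.
  exact: Cks_second_form.
by apply: Cks_mul => //; exact: Cks_second_form.
Qed.

Lemma Cks_area k : Cks k U W.
Proof.
apply: (@Cks_ext _ _ _ (fun x => (E x * G x - F x * F x) * (W x)^-1)) => //.
  move=> x Ux; rewrite -expr2 -area_density_sqr expr2 mulfK//.
  by rewrite gt_eqF// (area_density_gt0 hK Ux).
apply: Cks_mul => //; last exact: Cks_area_inv.
by apply: Cks_sub => //; apply: Cks_mul => //; exact: Cks_first_form.
Qed.

(** |H| >= 1 and H is continuous, so H cannot change sign near a
    point: in a product the sign of H can be differentiated as a constant. *)
Lemma sg_mean_near x : U x -> \forall y \near x, Num.sg (H y) = Num.sg (H x).
Proof.
move=> Ux; have cH : {for x, continuous H} := Cks_cts (Cks_mean 0) Ux.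
have H1 := mean_curvature_ge1 Ux.
have : \forall y \near x, `|H x - H y| < 1.
  by move/cvgrPdist_lt : cH; apply.
apply: filterS => y; rewrite ltr_norml => /andP[h1 h2].
move: (H x) (H y) H1 h1 h2 => a b H1 h1 h2; have [Hx|Hx] := lerP 0 a.
  rewrite ger0_norm// in H1; rewrite !gtr0_sg//; lra.
by rewrite ltr0_norm// in H1; rewrite !ltr0_sg//; lra.
Qed.

Variables (p : 'rV[R]_3) (X : R * R -> 'rV[R]_3).
Hypothesis hX : forall x, U x -> X x = psi x - p.

Lemma is_derive_position i x : U x -> is_derive x (basis2 R i) X (partial i psi x).
Proof.
move=> Ux; apply: (@near_eq_is_derive _ _ _ (fun x => psi x - p)).
  by apply: filterS (open_nbhs_nbhs (conj oU Ux)) => y /hX.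
have h := is_derive_surface oU hK i Ux.
by apply: (is_derive_eq (is_deriveB h (is_derive_cst p _ _))); rewrite subr0.
Qed.

Lemma Ckv_position k : Ckv k U X.
Proof.
move=> j; apply: (@Cks_ext _ _ _ (fun x => psi x 0 j - p 0 j)) => //.
  by move=> x Ux; rewrite hX// !mxE.
by apply: Cks_sub => //; [exact: Ckv_surface|exact: Cks_cst].
Qed.

(** The 1-form <X, N x dN>. *)
Definition beta i x := dotp (X x) (crossp (N x) (partial i N x)).

Lemma Cks_beta i k : Cks k U (beta i).
Proof.
apply: Ckv_dotp => //; first exact: Ckv_position.
apply: Ckv_crossp => //; first exact: Ckv_normal.
by apply: Ckv_partial => //; exact: Ckv_normal.
Qed.

Definition sdist x := dotp (X x) (X x) / 2.

Lemma is_derive_sdist i x : U x ->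
  is_derive x (basis2 R i) sdist (dotp (X x) (partial i psi x)).
Proof.
move=> Ux; have hd := is_derive_position i Ux.
have h := is_derive_mulR (is_derive_dotp hd hd) (is_derive_cst (2^-1 : R) _ _).
apply: (is_derive_eq h); rewrite mulr0 addr0 (dotpC (partial _ _ _)) /cst.
by field.
Qed.

Lemma pd_beta i j x : U x -> pd i (beta j) x =
  dotp (partial i psi x) (crossp (N x) (partial j N x)) +
  (dotp (X x) (crossp (partial i N x) (partial j N x)) +
   dotp (X x) (crossp (N x) (partial i (partial j N) x))).
Proof.
move=> Ux; apply: etrans _ (congr1 (+%R _) (dotpDr _ _ _)).
apply: pdE; apply: is_derive_dotp; first exact: is_derive_position.
apply: is_derive_crossp; first exact: (is_derive_normal oU hK).
by apply: (Ckv_derive i _ Ux); apply: Ckv_partial => //; exact: (Ckv_normal oU hK 2).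
Qed.

Lemma flux_curl x : U x -> pd 0 (beta 1) x - pd 1 (beta 0) x =
  2 * H x * W x + 2 * W x * dotp (X x) (N x).
Proof.
move=> Ux; have W0 : W x != 0 by rewrite gt_eqF// (area_density_gt0 hK Ux).
rewrite (pd_beta 0 1 Ux).
rewrite (pd_beta 1 0 Ux).
rewrite (partialC oU (Ckv_normal oU hK 2) Ux).
have hN := scale_normal hK Ux; have nn := normal_unit hK Ux.
have d i := normal_dnormal oU hK i Ux; have II := dnormal_tangent oU hK _ _ Ux.
have II' : dotp (partial 1 N x) (partial 0 psi x) = - f x.
  by rewrite II (second_form_sym oU hK Ux).
have K1 := det_second_form oU hK Ux.
apply: etrans (@flux_total R _ _ _ _ _ (X x) (W x) (e x) (f x) (g x) W0 hN nn (d 0) (d 1) (II 0 0) (II 0 1) II' (II 1 1) _ K1) _.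
congr (_ + _); rewrite (mean_curvatureE oU hK Ux) /mean_num.
rewrite -/(first_E psi x) -/(first_F psi x) -/(first_G psi x).
by field.
Qed.

Lemma flux_radial_ge0 x : U x -> 0 <= Num.sg (H x) *
  (dotp (X x) (partial 0 psi x) * beta 1 x -
   dotp (X x) (partial 1 psi x) * beta 0 x).
Proof.
move=> Ux; have W0 := area_density_gt0 hK Ux.
have hN := scale_normal hK Ux; have II := dnormal_tangent oU hK _ _ Ux.
have II' : dotp (partial 1 N x) (partial 0 psi x) = - f x.
  by rewrite II (second_form_sym oU hK Ux).
have e1 := @flux_radial R _ _ _ _ _ (X x) (W x) (e x) (f x) (g x) hN (II 0 0) (II 0 1) II' (II 1 1).
have sT : Num.sg (H x) = Num.sg (T x).
  rewrite (mean_curvatureE oU hK Ux) sgrM.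
  by rewrite [X in _ * X]gtr0_sg ?mulr1// invr_gt0 mulr_gt0// exprn_gt0.
rewrite sT -(pmulr_rge0 _ W0) mulrCA e1.
have W20 : 0 < W x ^+ 2 by rewrite exprn_gt0.
have D0 : 0 < E x * G x - F x ^+ 2 by rewrite -area_density_sqr.
have K0 : 0 < e x * g x - f x ^+ 2 by rewrite (det_second_form oU hK Ux).
exact: (definite_sign _ _ (first_E_gt0 Ux) D0 K0). 
Qed.

Variables (theta theta' : R -> R).
Hypothesis theta_derive : forall t : R, is_derive t 1 theta (theta' t).
Hypothesis theta01 : forall t, 0 <= theta t <= 1.
Hypothesis theta'_ge0 : forall t, 0 <= theta' t.

(** The 1-form theta(s) sgn(H) beta; [dflow] is its partial derivative as given
    by the product rule, sgn H being locally constant. *)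
Definition flow j x := theta (sdist x) * (Num.sg (H x) * beta j x).

Definition dflow i j x :=
  theta' (sdist x) * dotp (X x) (partial i psi x) * (Num.sg (H x) * beta j x) +
  theta (sdist x) * (Num.sg (H x) * pd i (beta j) x).

Lemma is_derive_flow i j x : U x ->
  is_derive x (basis2 R i) (flow j) (dflow i j x).
Proof.
move=> Ux; have aux (a b c : R) : b = a -> a * c = b * c by move=> ->.
apply: is_derive_mulR.
  exact: is_derive_compR (is_derive_sdist i Ux).
apply: (@near_eq_is_derive _ _ _ (fun y => Num.sg (H x) * beta j y)).
  apply: filterS (sg_mean_near Ux) => y E; exact: aux E.
have hb := pdP (@Cks_derivable _ _ _ _ i _ (Cks_beta j 1) Ux).
apply: (is_derive_eq (is_derive_mulR (is_derive_cst (Num.sg (H x)) _ _) hb)).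
by rewrite mul0r add0r.
Qed.

Hypothesis theta'_continuous : continuous theta'.

Lemma weight_continuous : continuous theta.
Proof.
move=> t; apply/differentiable_continuous/derivable1_diffP.
by have h := theta_derive t; exact: ex_derive.
Qed.

Lemma continuous_sdist_on x : U x -> {for x, continuous sdist}.
Proof.
move=> Ux; apply: cvgM; last exact: cvg_cst.
exact: Cks_cts (Ckv_dotp oU (Ckv_position 0) (Ckv_position 0)) Ux.
Qed.

Lemma cts_sg_mean x : U x -> {for x, continuous (fun y => Num.sg (H y))}.
Proof.
by move=> Ux; apply: cvg_near_cst; exact: sg_mean_near. Qed.

Lemma cts_flow j x : U x -> {for x, continuous (flow j)}.
Proof.
move=> Ux; rewrite /prop_for /continuous_at /flow; apply: cvgM.
  by apply: continuous_comp; [exact: continuous_sdist_on|exact: weight_continuous].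
apply: cvgM; first exact: cts_sg_mean.
exact: Cks_cts (Cks_beta j 0) Ux.
Qed.

Lemma cts_dflow i j x : U x -> {for x, continuous (dflow i j)}.
Proof.
move=> Ux; rewrite /prop_for /continuous_at /dflow; apply: cvgD.
  apply: cvgM; last first.
    by apply: cvgM; [exact: cts_sg_mean|exact: Cks_cts (Cks_beta j 0) Ux].
  apply: cvgM.
    by apply: continuous_comp; [exact: continuous_sdist_on|exact: theta'_continuous].
  apply: Cks_cts Ux; apply: (Ckv_dotp oU (Ckv_position 0)).
  by apply: Ckv_partial => //; exact: Ckv_surface.
apply: cvgM.
  by apply: continuous_comp; [exact: continuous_sdist_on|exact: weight_continuous].
apply: cvgM; first exact: cts_sg_mean.
exact: Cks_cts (Cks_partial i (Cks_beta j 1)) Ux.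
Qed.

Lemma flow_le j x : `|flow j x| <= `|beta j x|.
Proof.
rewrite /flow normrM normrM mulrA -[leRHS]mul1r ler_wpM2r//.
have /andP[t0 t1] := theta01 (sdist x); rewrite (ger0_norm t0) normr_sg.
by rewrite -[leRHS]mulr1 ler_pM//; case: (_ != 0).
Qed.

(** Used at the singularity, near which psi is so close to p that the weight
    vanishes: there the weighted form extends by zero. *)
Lemma flow_zero_near i j x : (\forall y \near x, theta (sdist y) = 0) ->
  (\forall y \near x, theta' (sdist y) = 0) ->
  [/\ is_derive x (basis2 R i) (flow j) (dflow i j x),
      {for x, continuous (flow j)} & {for x, continuous (dflow i j)}].
Proof.
move=> nt ndt.
have f0 : \forall y \near x, flow j y = 0.
  by apply: filterS nt => y h; rewrite /flow h mul0r.
have df0 : \forall y \near x, dflow i j y = 0.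
  by apply: filterS2 nt ndt => y h h'; rewrite /dflow h h' !mul0r addr0.
split.
- rewrite (nbhs_singleton df0); apply: (@near_eq_is_derive _ _ _ (cst 0)) => //.
  by apply: filterS f0 => y ->.
- rewrite /prop_for /continuous_at (nbhs_singleton f0).
  exact: cvg_near_cst.
- rewrite /prop_for /continuous_at (nbhs_singleton df0).
  exact: cvg_near_cst.
Qed.

Lemma flow_divergence_le M x : U x -> `|dotp (X x) (N x)| <= M ->
  2 * theta (sdist x) * `|H x| * W x <=
  dflow 0 1 x - dflow 1 0 x + 2 * M * W x.
Proof.
move=> Ux XM.
exact: (flow_ineq (theta01 _) (theta'_ge0 _) (area_density_gt0 hK Ux) XM (flux_radial_ge0 Ux)
  (flux_curl Ux)).
Qed.

End Flux.

(** * Uniform bound for the weighted mean curvature *)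

Lemma open_setX (S T : topologicalType) (A : set S) (B : set T) :
  open A -> open B -> open (A `*` B).
Proof.
move=> oA oB; rewrite openE => -[s t] [/= As Bt].
by exists (A, B) => //=; split; exact: open_nbhs_nbhs.
Qed.

Section Main.
Variable R : realType.
Local Notation RR := (measurableTypeR R * measurableTypeR R)%type.
Notation mu2 := (@lebesgue2 R).
Variables (D : set (R * R)) (q : R * R) (psi : R * R -> 'rV[R]_3) (p : 'rV[R]_3).
Hypotheses (oD : open D) (hK : K_surface (punctured q D) psi).
Local Notation Dq := (punctured q D).
Local Notation W := (area_density psi).
Local Notation H := (mean_curvature psi).
Local Notation N := (unit_normal psi).

Lemma open_punctured (U : set (R * R)) : open U -> open (punctured q U).
Proof.
move=> oU; rewrite /punctured setDE; apply: openI => //.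
by apply: closed_openC; apply: accessible_closed_set1; exact: hausdorff_accessible.
Qed.

Let oDq : open Dq. Proof. exact: open_punctured. Qed.

Lemma sub_punctured (U : set (R * R)) : U `<=` D -> punctured q U `<=` Dq.
Proof. by move=> UD x [/UD]. Qed.

Variable X : R * R -> 'rV[R]_3.
Hypothesis hX : forall x, Dq x -> X x = psi x - p.
Hypothesis cX : forall x, D x -> {for x, continuous X}.
Hypothesis Xq : X q = 0.

Local Notation s := (sdist X).

Lemma sdist_continuous x : D x -> {for x, continuous s}.
Proof.
move=> Dx; have cc j : {for x, continuous (fun y => X y 0 j)}.
  apply: (@continuous_comp _ _ _ X (fun M : 'rV[R]_3 => M 0 j) x).
    exact: cX.
  exact: coord_continuous.
have -> : sdist X = (fun y => (X y 0 0 * X y 0 0 + X y 0 1 * X y 0 1 +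
   X y 0 (1 + 1) * X y 0 (1 + 1)) * 2^-1).
  by apply/funext => y; rewrite /sdist dotpE.
rewrite /prop_for /continuous_at; apply: cvgM; last exact: cvg_cst.
by apply: cvgD; [apply: cvgD|]; apply: cvgM; exact: cc.
Qed.

Lemma sdist_center : s q = 0.
Proof. by rewrite /sdist Xq dotpE !mxE !mulr0 !addr0 mul0r. Qed.

Lemma sdist_ge0 x : 0 <= s x.
Proof. by rewrite /sdist divr_ge0// dotp_ge0. Qed.

Lemma sdist_eq0 x : s x = 0 -> X x = 0.
Proof.
move=> sx; apply: dotp_eq0; move: sx; rewrite /sdist => /eqP.
by rewrite mulf_eq0 invr_eq0 pnatr_eq0 orbF => /eqP.
Qed.

(** The vertical derivative of X = psi - p is nonzero wherever psi is an
    immersion, so zeros of X are isolated in vertical lines. *)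
Lemma sdist_null : measurable (Dq `&` s @^-1` [set 0] : set RR) /\
  mu2 (Dq `&` s @^-1` [set 0]) = 0%E.
Proof.
apply: zero_set_null => // [x [Dx _]|a b Dab sab]; first exact: sdist_continuous.
have X0 := sdist_eq0 sab.
have hd := is_derive_position oDq hK hX 1 Dab.
have d0 : partial 1 psi (a, b) != 0.
  apply/eqP => d0; have := crossp_partials_gt0 hK Dab.
  rewrite d0 (_ : crossp _ 0 = 0) ?dotpE ?mxE ?mulr0 ?addr0 ?ltxx//.
  by apply/rowP => k; rewrite !mxE !mulr0 subrr.
have [j dj] : exists j, partial 1 psi (a, b) 0 j != 0.
  apply/existsP; apply: contraNT d0; rewrite negb_exists => /forallP H0.
  by apply/eqP/rowP => j; rewrite mxE; apply/eqP; have := H0 j; rewrite negbK.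
have /is_derive_row/(_ j)/is_derive_snd hj := hd.
have := derive_neq_near hj dj; apply: filterS => h.
by apply: contra_neq => /sdist_eq0 ->; rewrite X0.
Qed.

Variables (a b c d : R).
Hypotheses (ab : a < b) (cd : c < d).
Local Notation Q := ([set` `[a, b]] `*` [set` `[c, d]]).
Hypothesis QD : Q `<=` D.
Hypothesis qa : a < q.1 < b.
Hypothesis qc : c < q.2 < d.
Local Notation Qq := (punctured q Q).

Let mQ : measurable (Q : set RR). Proof. exact: rect_measurable. Qed.

Lemma punctured_rect_measurable : measurable (Qq : set RR).
Proof. by apply: measurableD => //; exact: set1_measurable_prod. Qed.
Local Notation mQq := punctured_rect_measurable.

Lemma Qq_sub : Qq `<=` Dq. Proof. exact: sub_punctured. Qed.

Lemma measurable_cts (f : R * R -> R) : (forall x, Dq x -> {for x, continuous f}) ->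
  measurable_fun (Qq : set RR) f.
Proof.
move=> cf; apply: (@measurable_funS _ _ _ _ (Dq : set RR)).
- exact: open_measurable_prod.
- exact: Qq_sub.
- exact: continuous_on_measurable.
Qed.

Lemma area_density_continuous x : Dq x -> {for x, continuous W}.
Proof. exact: Cks_cts (Cks_area oDq hK 0). Qed.

Lemma norm_mean_continuous x : Dq x -> {for x, continuous (fun x => `|H x|)}.
Proof.
move=> Dx; apply: continuous_comp; last exact: norm_continuous.
exact: Cks_cts (Cks_mean oDq hK 0) Dx.
Qed.

(** The boundary of the rectangle is a compact set that avoids the
    singularity. *)
Lemma beta_boundary j : exists B, forall x, Q x ->
  (x.1 == a) || (x.1 == b) || (x.2 == c) || (x.2 == d) ->
  `|beta psi X j x| <= B.
Proof.
pose K := Q `&` ~` ([set` `]a, b[] `*` [set` `]c, d[]).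
have cK : compact K.
  apply: compact_closedI; first exact: rect_compact.
  by apply: open_closedC; apply: open_setX; exact: interval_open.
have KD x : K x -> Dq x.
  move=> [Qx nx]; split; first exact: QD.
  by move=> xq; apply: nx; rewrite xq; split; rewrite /= in_itv.
have [B hB] := compact_bound cK (fun x Kx =>
  Cks_cts (Cks_beta oDq hK hX j 0) (KD x Kx)).
exists B => x Qx hx; apply: hB; split => // -[].
rewrite /= !in_itv/= => /andP[h1 h2] /andP[h3 h4].
move: hx; rewrite -!orbA => /or4P[] /eqP h.
- by rewrite h ltxx in h1.
- by rewrite h ltxx in h2.
- by rewrite h ltxx in h3.
- by rewrite h ltxx in h4.
Qed.

Lemma flow_regular k i j x : 0 < k -> D x ->
  [/\ is_derive x (basis2 R i) (flow psi X (cutoff k) j)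
        (dflow psi X (cutoff k) (dcutoff k) i j x),
      {for x, continuous (flow psi X (cutoff k) j)} &
      {for x, continuous (dflow psi X (cutoff k) (dcutoff k) i j)}].
Proof.
move=> k0 Dx; have hk := @is_derive_cutoff R k.
have [xq|/eqP xq] := eqVneq x q; last first.
  have Dqx : Dq x by [].
  split.
  - exact: (is_derive_flow oDq hK hX hk).
  - exact: (cts_flow oDq hK hX hk).
  - exact: (cts_dflow oDq hK hX hk (@continuous_dcutoff R k)).
have ns : \forall y \near x, k * s y - 1 <= 0.
  have /cvgrPdist_lt/(_ k^-1) := sdist_continuous Dx; rewrite invr_gt0 => /(_ k0).
  rewrite xq sdist_center; apply: filterS => y; rewrite sub0r normrN ger0_norm ?sdist_ge0//.
  by move=> /ltW h; rewrite subr_le0 -(mulfV (lt0r_neq0 k0)) ler_pM2l.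
apply: flow_zero_near.
  by apply: filterS ns => y; exact: ramp_eq0.
apply: filterS ns => y h.
by rewrite /dcutoff /dramp max_l// mulr0 mul0r mulr0.
Qed.

Local Notation dv k x := (dflow psi X (cutoff k) (dcutoff k) 0 1 x -
   dflow psi X (cutoff k) (dcutoff k) 1 0 x).

Lemma div_cts k x : 0 < k -> D x -> {for x, continuous (fun x => dv k x)}.
Proof.
move=> k0 Dx; have [_ _ c1] := flow_regular 0 1 k0 Dx.
have [_ _ c2] := flow_regular 1 0 k0 Dx.
exact: (cvgB c1 c2).
Qed.

(** The weights lie in [0, 1], so on the boundary the weighted form is bounded
    by the unweighted one, whatever the value of k. *)
Lemma div_bound : exists C : R, forall k, 0 < k ->
  (\int[mu2]_(x in Q) (dv k x)%:E <= C%:E)%E.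
Proof.
have [B1 hB1] := beta_boundary 1; have [B0 hB0] := beta_boundary 0.
exists (2 * B1 * (d - c) + 2 * B0 * (b - a)) => k k0.
have h1 x (Dx : D x) := flow_regular 0 1 k0 Dx.
have h0 x (Dx : D x) := flow_regular 1 0 k0 Dx.
have aE : a \in `[a, b] by rewrite in_itv/= lexx ltW.
have bE : b \in `[a, b] by rewrite in_itv/= lexx ltW.
have cE : c \in `[c, d] by rewrite in_itv/= lexx ltW.
have dE : d \in `[c, d] by rewrite in_itv/= lexx ltW.
have c1 x : D x -> {for x, continuous (dflow psi X (cutoff k) (dcutoff k) 0 1)}.
  by move=> /h1[].
have c0 x : D x ->
    {for x, continuous (fun y => - dflow psi X (cutoff k) (dcutoff k) 1 0 y)}.
  by move=> /h0[_ _]; exact: cvgN.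
have -> : (\int[mu2]_(x in Q) (dv k x)%:E =
   \int[mu2]_(x in Q) ((dflow psi X (cutoff k) (dcutoff k) 0 1 x)%:E +
     (- dflow psi X (cutoff k) (dcutoff k) 1 0 x)%:E))%E by [].
rewrite integralD//; try exact: (rect_integrable ab cd oD QD).
rewrite EFinD; apply: leeD.
- apply: (green_fst ab cd oD QD (G := flow psi X (cutoff k) 1)) => //.
  + by move=> x /h1[].
  + by move=> x /h1[].
  + move=> y ycd; split; apply: le_trans (flow_le _ _ (@cutoff01 R k) _ _) _.
      by apply: hB1; rewrite ?eqxx//; split.
    by apply: hB1; rewrite ?eqxx ?orbT//; split.
- apply: (green_snd ab cd oD QD (G := fun x => - flow psi X (cutoff k) 0 x)) => //.
  + by move=> x /h0[h _ _]; exact: is_deriveN.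
  + by move=> x /h0[_ h _]; exact: cvgN.
  + have fb x : `|- flow psi X (cutoff k) 0 x| <= `|beta psi X 0 x|.
      by rewrite normrN; exact: flow_le (@cutoff01 R k) _ _.
    move=> x xab; split; apply: le_trans (fb _) _.
      by apply: hB0; rewrite ?eqxx ?orbT//; split.
    by apply: hB0; rewrite ?eqxx ?orbT//; split.
Qed.

Hypothesis hA : (\int[mu2]_(x in Qq) (W x)%:E < +oo)%E.

Lemma area_density_ge0 x : 0 <= W x.
Proof. by rewrite area_densityE sqrtr_ge0. Qed.

Lemma area_density_integrable : mu2.-integrable (Qq : set RR) (EFin \o W).
Proof.
apply/integrableP; split.
  by apply/measurable_EFinP; exact: measurable_cts area_density_continuous.
rewrite (_ : (fun x => _) = EFin \o W)//.
by apply/funext => x /=; rewrite ger0_norm// area_density_ge0.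
Qed.

(** This is where finite area enters: on the rectangle |<X, N>| is bounded by
    (|X|^2 + 1) / 2, hence by a constant M. *)
Lemma weight_bound : exists C : R, forall k, 0 < k ->
  (\int[mu2]_(x in Qq) (2 * cutoff k (s x) * `|H x| * W x)%:E <= C%:E)%E.
Proof.
have [C1 hC1] := div_bound.
have [S hS] := compact_bound (@rect_compact R a b c d) (fun x Qx => sdist_continuous (QD Qx)).
pose M := S + 1 / 2.
have XN x : Qq x -> `|dotp (X x) (N x)| <= M.
  move=> Qx; have Dx := Qq_sub Qx; apply: le_trans (dotp_le_half _ _) _.
  rewrite (normal_unit hK Dx) mulrDl lerD2r.
  by apply: le_trans (hS x Qx.1); exact: ler_norm.
have iMW : mu2.-integrable (Qq : set RR) (fun x => (2 * M * W x)%:E).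
  have := integrableZl mQq (2 * M) area_density_integrable.
  by congr (integrable _ _ _); apply/funext => x /=; rewrite EFinM.
pose A := (\int[mu2]_(x in Qq) (2 * M * W x)%:E)%E.
have fA : A \is a fin_num := integrable_fin_num mQq iMW.
exists (C1 + fine A) => k k0.
have iV : mu2.-integrable (Q : set RR) (EFin \o (fun x => dv k x)).
  exact: (rect_integrable ab cd oD QD (fun x => @div_cts k x k0)).
have iVq : mu2.-integrable (Qq : set RR) (EFin \o (fun x => dv k x)).
  by apply: integrableS iV => //; [exact: mQq|move=> x []].
apply: (@le_trans _ _ (\int[mu2]_(x in Qq)
    ((dv k x)%:E + (2 * M * W x)%:E))%E).
  apply: ge0_le_integral.
  - exact: mQq.
  - move=> x _; rewrite lee_fin; have /andP[t0 _] := cutoff01 k (s x).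
    by rewrite mulr_ge0 ?area_density_ge0// mulr_ge0// mulr_ge0.
  - apply/measurable_EFinP; apply: measurable_cts => x Dx.
    apply: cvgM; last exact: area_density_continuous.
    apply: cvgM; last exact: norm_mean_continuous.
    apply: cvgM; first exact: cvg_cst.
    apply: continuous_comp; first by apply: sdist_continuous; case: Dx.
    exact: weight_continuous (@is_derive_cutoff R k) _.
  - apply: emeasurable_funD; first exact: measurable_int iVq.
    exact: measurable_int iMW.
  - move=> x Qx; rewrite -EFinD lee_fin.
    exact: (flow_divergence_le oDq hK hX (@cutoff01 R k)
      (fun t => dcutoff_ge0 t (ltW k0)) (Qq_sub Qx) (XN x Qx)).
rewrite integralD//; last exact: mQq.
rewrite EFinD fineK// leeD2r// -/(punctured q Q).
rewrite -[leLHS](@negligible_integral _ _ _ mu2 Q [set q] (EFin \o (fun x => dv k x)))//.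
- exact: hC1.
- exact: set1_measurable_prod.
- exact: lebesgue2_set1.
Qed.

(** The sets En, on which the n-th weight is at least 1/2, exhaust the points
    where psi differs from p. *)
Lemma mean_curvature_integral_lty : (\int[mu2]_(x in Qq) (`|H x| * W x)%:E < +oo)%E.
Proof.
have [C hC] := weight_bound.
pose En (n : nat) : set RR := Qq `&` (fun x => n.+1%:R * s x) @^-1` `[2, +oo[.
have mhw : measurable_fun (Qq : set RR) (fun x => (`|H x| * W x)%:E).
  apply/measurable_EFinP; apply: measurable_cts => x Dx.
  by apply: cvgM; [exact: norm_mean_continuous|exact: area_density_continuous].
have ms n : measurable_fun (Qq : set RR) (fun x => n.+1%:R * s x).
  apply: measurable_cts => x [Dx _].
  by apply: cvgM; [exact: cvg_cst|exact: sdist_continuous].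
have mE n : measurable (En n).
  by apply: ms; [exact: mQq|exact: measurable_itv].
have hw0 x : (0 <= (`|H x| * W x)%:E)%E.
  by rewrite lee_fin mulr_ge0// area_density_ge0.
have EQ n : En n `<=` Qq by move=> x [].
(* On En the factor 2 theta(s) is at least 1. *)
have leC n : (\int[mu2]_(x in En n) (`|H x| * W x)%:E <= C%:E)%E.
  have n0 : 0 < n.+1%:R :> R by [].
  apply: le_trans (hC _ n0).
  set L := fun x => (2 * cutoff n.+1%:R (s x) * `|H x| * W x)%:E.
  have L0 x : (0 <= L x)%E.
    rewrite lee_fin; have /andP[t0 _] := cutoff01 n.+1%:R (s x).
    by rewrite mulr_ge0 ?area_density_ge0// mulr_ge0// mulr_ge0.
  have mL : measurable_fun (Qq : set RR) L.
    apply/measurable_EFinP; apply: measurable_cts => x Dx.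
    apply: cvgM; last exact: area_density_continuous.
    apply: cvgM; last exact: norm_mean_continuous.
    apply: cvgM; first exact: cvg_cst.
    apply: continuous_comp; first by apply: sdist_continuous; case: Dx.
    exact: weight_continuous (@is_derive_cutoff R n.+1%:R) _.
  apply: (@le_trans _ _ (\int[mu2]_(x in En n) L x)%E); last first.
    by apply: ge0_subset_integral => //; exact: mQq.
  apply: ge0_le_integral => //.
  - exact: (measurable_funS mQq (EQ n) mhw).
  - exact: (measurable_funS mQq (EQ n) mL).
  - move=> x [_]; rewrite /= in_itv/= andbT => sx; rewrite lee_fin.
    rewrite -mulrA ler_peMl ?mulr_ge0 ?area_density_ge0//.
    have := @ramp_ge_half R (n.+1%:R * s x - 1).
    by rewrite /cutoff => /(_ ltac:(lra)); lra.
have ndE : nondecreasing_seq En.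
  apply/nondecreasing_seqP => n; apply/subsetPset => x [Qx].
  rewrite /= !in_itv/= !andbT => h; split => //.
  rewrite /= in_itv/= andbT (le_trans h)// ler_wpM2r ?sdist_ge0//.
  by rewrite ler_nat.
have cvE := @ge0_nondecreasing_set_cvg_integral _ RR R En
  (fun x => (`|H x| * W x)%:E) mu2 ndE mE
  (fun n => measurable_funS mQq (EQ n) mhw) (fun _ x _ => hw0 x).
have UE : \bigcup_n En n = Qq `\` (Dq `&` s @^-1` [set 0]).
  apply/seteqP; split=> [x [n _ [Qx]]|x [Qx nx]].
    rewrite /= in_itv/= andbT => h; split => // -[_ /= s0].
    by move: h; rewrite s0 mulr0 lern0.
  have s0 : 0 < s x.
    rewrite lt_def sdist_ge0 andbT; apply/eqP => s0; apply: nx.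
    by split => //; exact: Qq_sub.
  have [n hn] : exists n : nat, 2 / s x <= n%:R.
    exists (Num.truncn (2 / s x)).+1; apply: ltW; exact: truncnS_gt.
  exists n => //; split => //; rewrite /= in_itv/= andbT.
  rewrite -ler_pdivrMr// (le_trans hn)// ler_nat.
  exact: leqnSn.
have [mZ Z0] := sdist_null.
rewrite (ge0_negligible_integral mZ mQq mhw (fun x _ => hw0 x) Z0) -UE.
apply: le_lt_trans (ltry C).
rewrite -(cvg_lim _ cvE)//.
apply: lime_le; first by apply/cvg_ex; eexists; exact: cvE.
exact: nearW.
Qed.

End Main.

(** * The equivalence *)

Lemma disc_open (R : realType) (q : R * R) (rho : R) : open (disc q rho).
Proof.
pose f (x : R * R) := (x.1 - q.1) ^+ 2 + (x.2 - q.2) ^+ 2.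
have -> : disc q rho = f @^-1` [set t | t < rho ^+ 2] by [].
apply: open_comp; last exact: open_lt.
move=> x _; rewrite /f; apply: cvgD; apply: cvgM; apply: cvgB;
  by [exact: cvg_fst|exact: cvg_snd|exact: cvg_cst].
Qed.

Section Final.
Variable R : realType.
Local Notation RR := (measurableTypeR R * measurableTypeR R)%type.
Variables (D : set (R * R)) (q : R * R) (psi : R * R -> 'rV[R]_3).
Hypotheses (oD : open D) (hK : K_surface (punctured q D) psi).
Let oDq : open (punctured q D). Proof. exact: open_punctured. Qed.

Lemma mean_finite_area_finite : finite_total_mean_curvature_around D q psi ->
  finite_area_around D q psi.
Proof.
move=> [U [oU Uq UD fin]]; exists U; split => //.
have UDq := @sub_punctured R D q U UD.
have mU : measurable (punctured q U : set RR).
  by apply: open_measurable_prod; apply: open_punctured.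
have mf (f : R * R -> R) : (forall x, punctured q D x -> {for x, continuous f}) ->
    measurable_fun (punctured q U : set RR) f.
  move=> cf; apply: (@measurable_funS _ _ _ _ (punctured q D : set RR)) => //.
    exact: open_measurable_prod.
  exact: continuous_on_measurable.
apply: le_lt_trans fin; apply: ge0_le_integral.
- exact: mU.
- by move=> x _; rewrite lee_fin mul1r area_density_ge0.
- apply/measurable_EFinP; apply: mf => x Dx; apply: cvgM; first exact: cvg_cst.
  exact: (area_density_continuous oD hK Dx).
- apply/measurable_EFinP; apply: mf => x Dx; apply: cvgM; first exact: (norm_mean_continuous oD hK Dx).
  exact: (area_density_continuous oD hK Dx).
- move=> x /UDq Dx; rewrite lee_fin ler_wpM2r ?area_density_ge0//.
  exact: (mean_curvature_ge1 oDq hK Dx).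
Qed.

Lemma area_finite_mean_finite (p : 'rV[R]_3) : isolated_singularity D q psi p ->
  finite_area_around D q psi -> finite_total_mean_curvature_around D q psi.
Proof.
move=> [Psi [cPsi PsiE Psiq]] [U [oU Uq UD fin]].
have UDq := @sub_punctured R D q U UD.
have cX x : D x -> {for x, continuous (fun y => Psi y - p)}.
  move=> Dx; apply: cvgB; last exact: cvg_cst.
  by move: cPsi; rewrite continuous_open_subspace// => /(_ x (mem_set Dx)).
have hX x : punctured q D x -> Psi x - p = psi x - p by move=> /PsiE ->.
have Xq : Psi q - p = 0 by rewrite Psiq subrr.
have /nbhs_ballP[e /= e0 eU] : nbhs q U by exact: open_nbhs_nbhs.
pose r := e / 2; have r0 : 0 < r by rewrite divr_gt0.
have re : r < e by rewrite /r ltr_pdivrMr// ltr_pMr// ltr1n.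
pose a := q.1 - r; pose b := q.1 + r; pose c := q.2 - r; pose d := q.2 + r.
have ab : a < b by rewrite /a /b; lra.
have cd : c < d by rewrite /c /d; lra.
have qa : a < q.1 < b by rewrite /a /b; apply/andP; split; lra.
have qc : c < q.2 < d by rewrite /c /d; apply/andP; split; lra.
have QU : [set` `[a, b]] `*` [set` `[c, d]] `<=` U.
  move=> x [] /=; rewrite !in_itv/= /a /b /c /d => /andP[h1 h2] /andP[h3 h4].
  by apply: eU; split; rewrite /= /ball/= ltr_distlC; apply/andP; split; lra.
have QD := subset_trans QU UD.
have QUq : punctured q ([set` `[a, b]] `*` [set` `[c, d]]) `<=` punctured q U.
  by move=> x [/QU].
have mU : measurable (punctured q U : set RR).
  by apply: open_measurable_prod; apply: open_punctured.
have mf (A : set (R * R)) (f : R * R -> R) : A `<=` punctured q D ->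
    (forall x, punctured q D x -> {for x, continuous f}) ->
    measurable_fun (A : set RR) f.
  move=> AD cf; apply: (@measurable_funS _ _ _ _ (punctured q D : set RR)) => //.
    exact: open_measurable_prod.
  exact: continuous_on_measurable.
have hA : (\int[@lebesgue2 R]_(x in punctured q ([set` `[a, b]] `*` [set` `[c, d]]))
    (area_density psi x)%:E < +oo)%E.
  apply: le_lt_trans fin.
  rewrite /area_integral (_ : (fun x => (1 * _)%:E) =
    (fun x => (area_density psi x)%:E)); last first.
    by apply/funext => x; rewrite mul1r.
  apply: ge0_subset_integral => //.
  - exact: punctured_rect_measurable.
  - by apply/measurable_EFinP; apply: mf => // x Dx; exact: (area_density_continuous oD hK Dx).
  - by move=> x _; rewrite lee_fin area_density_ge0.
have mfin := mean_curvature_integral_lty oD hK hX cX Xq ab cd QD qa qc hA.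
exists ([set` `]a, b[] `*` [set` `]c, d[]).
have subQ : [set` `]a, b[] `*` [set` `]c, d[] `<=` [set` `[a, b]] `*` [set` `[c, d]].
  move=> x [] /= h1 h2.
  by split; rewrite /=; [exact: subset_itv_oo_cc h1|exact: subset_itv_oo_cc h2].
have oQ : open ([set` `]a, b[] `*` [set` `]c, d[]).
  by apply: open_setX; exact: interval_open.
split => //.
- exact: subset_trans subQ QD.
- apply: le_lt_trans mfin; apply: ge0_subset_integral => //.
  + by apply: open_measurable_prod; apply: open_punctured.
  + exact: punctured_rect_measurable.
  + apply/measurable_EFinP; apply: mf => [x /QUq/UDq//|x Dx].
    by apply: cvgM; [exact: (norm_mean_continuous oD hK Dx)|exact: (area_density_continuous oD hK Dx)].
  + by move=> x _; rewrite lee_fin mulr_ge0// area_density_ge0.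
  + by move=> x [/subQ].
Qed.

End Final.

Theorem proposition4 (R : realType) (q : (R * R)%type) (rho : R)
    (hrho : (0 < rho)%R)
    (psi : (R * R)%type -> 'rV[R]_3) (p : 'rV[R]_3)
    (hK : K_surface (punctured q (disc q rho)) psi)
    (hp : isolated_singularity (disc q rho) q psi p) :
  finite_area_around (disc q rho) q psi <->
  finite_total_mean_curvature_around (disc q rho) q psi.
Proof.
have oD := @disc_open R q rho; split.
  exact: (area_finite_mean_finite oD hK hp).
exact: (mean_finite_area_finite oD hK).
Qed.
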